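(* Let $\Gamma$ be a finitely generated subgroup of $PL_o(I)$, the group of orientation preserving piecewise linear homeomorphisms of the closed interval $I=[0,1]$. Then $\Gamma$ is solvable or $\mathrm{girth}(\Gamma)=\infty$.
   Context: $PL_o(I)$ is the group, under composition, of orientation preserving piecewise linear homeomorphisms of $I=[0,1]$ (each element having only finitely many points of non-differentiability). For a finitely generated group $\Gamma$ and a finite generating set $S$ of $\Gamma$, $\mathrm{girth}(\Gamma,S)$ is the minimal length of a relation among the elements of $S$, i.e. the minimal length of a non-trivial reduced word in the free group formally generated by the elements of $S$ which represents the identity of $\Gamma$ ($\infty$ if there is no such word). Then $\mathrm{girth}(\Gamma)=\sup \mathrm{girth}(\Gamma,S)$, where the supremum is over all finite generating sets $S$ of $\Gamma$. In particular an infinite cyclic group has infinite girth; the two alternatives are not claimed to be mutually exclusive. *)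

(* Defs.v *)
From HB Require Import structures.
From mathcomp Require Import all_boot all_order all_algebra.
From mathcomp Require Import all_classical all_reals all_analysis.

Set Implicit Arguments.
Unset Strict Implicit.
Unset Printing Implicit Defensive.

Import Order.TTheory GRing.Theory Num.Theory.
Import numFieldNormedType.Exports.

Local Open Scope classical_set_scope.
Local Open Scope ring_scope.

Section Groups.
Local Open Scope group_scope.
Variable G : groupType.
Implicit Types (H S : set G) (w : seq (G * bool)).

Definition subgroup H : Prop := group_closed (mem H).

Definition generated S : set G := smallest subgroup S.

Definition generates S H : Prop := finite_set S /\ generated S = H.

Definition finitely_generated H : Prop := exists S, generates S H.

Definition derived H : set G := generated [set [~ x, y] | x in H & y in H].

Definition solvable_group H : Prop := exists n, iter n derived H = [set 1].

(* The letter (s, b) stands for s if b = false and for s^-1 if b = true.      *)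
(* Letters are formal: if s and s^-1 both lie in S, then (s^-1, false) and    *)
(* (s, true) are different letters.                                           *)
Definition reduced w : bool :=
  sorted (fun l l' => ~~ ((l.1 == l'.1) && (l.2 != l'.2))) w.

Definition word_eval w : G := \prod_(l <- w) (if l.2 then l.1^-1 else l.1).

Definition girth_relation S w : Prop :=
  [/\ w <> [::], reduced w, (forall l, l \in w -> S l.1) & word_eval w = 1].

(* The infimum of the empty set is +oo.                                       *)
Definition girth_wrt (R : realType) S : \bar R :=
  ereal_inf [set (size w)%:R%:E | w in girth_relation S].

Definition girth (R : realType) H : \bar R :=
  ereal_sup [set girth_wrt R S | S in [set S | generates S H]].

End Groups.

Definition homeomorphism (X Y : topologicalType) (f : X -> Y) : Prop :=
  exists g : Y -> X,
    [/\ cancel f g, cancel g f, continuous f & continuous g].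

Section PiecewiseLinear.
Variable R : realType.

Definition unit_itv : Type := set_type (`[0, 1]%classic : set R).

Implicit Types f g : unit_itv -> unit_itv.

Definition orientation_preserving f : Prop :=
  forall x y : unit_itv, val x < val y -> val (f x) < val (f y).

Definition affine_on f (a b : unit_itv) : Prop :=
  exists m c : R,
    forall x : unit_itv, val a <= val x <= val b -> val (f x) = m * val x + c.

(* B contains the breakpoints of f: f is affine on every [a, b] with no point *)
(* of B in its interior.                                                      *)
Definition piecewise_linear f : Prop :=
  exists B : set unit_itv, finite_set B /\
    forall a b : unit_itv, (forall x, B x -> ~~ (val a < val x < val b)) ->
      affine_on f a b.

Definition is_PLo f : Prop :=
  [/\ homeomorphism f, orientation_preserving f & piecewise_linear f].

Record PLo : Type := MkPLo {
  PLo_fun :> unit_itv -> unit_itv;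
  PLoP : is_PLo PLo_fun
}.

HB.instance Definition _ := gen_eqMixin PLo.
HB.instance Definition _ := gen_choiceMixin PLo.

Lemma PLo_inj (f g : PLo) : f = g :> (unit_itv -> unit_itv) -> f = g.
Proof.
case: f g => [f fP] [g gP] /= e; case: _ / e gP => gP.
by rewrite (Prop_irrelevance fP gP).
Qed.

Lemma orientation_preserving_le f : orientation_preserving f ->
  forall x y : unit_itv, (val (f x) <= val (f y)) = (val x <= val y).
Proof.
move=> fo x y; apply/idP/idP.
  by apply: contraTT; rewrite -!ltNge; apply: fo.
rewrite le_eqVlt => /predU1P[/val_inj -> //|xy].
by apply/ltW/fo.
Qed.

Lemma orientation_preserving_lt f : orientation_preserving f ->
  forall x y : unit_itv, (val (f x) < val (f y)) = (val x < val y).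
Proof. by move=> fo x y; rewrite !ltNge orientation_preserving_le. Qed.

Lemma is_PLo_id : is_PLo id.
Proof.
split=> //; first by exists id; split=> // x; exact: cvg_id.
exists set0; split; first exact: finite_set0.
by move=> a b _; exists 1, 0 => x _; rewrite mul1r addr0.
Qed.

Lemma is_PLo_comp f g : is_PLo f -> is_PLo g -> is_PLo (f \o g).
Proof.
move=> [[f' [fK f'K fc f'c]] fo [Bf [finf fa]]].
move=> [[g' [gK g'K gc g'c]] go [Bg [fing ga]]]; split.
- exists (g' \o f'); split; [exact: can_comp|exact: can_comp| |].
    by move=> x; apply: continuous_comp; [exact: gc|exact: fc].
  by move=> x; apply: continuous_comp; [exact: f'c|exact: g'c].
- by move=> x y xy; apply/fo/go.
exists (Bg `|` g' @` Bf); split.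
  by rewrite finite_setU; split => //; exact: finite_image.
move=> a b noB.
have [|m [c gE]] := ga a b; first by move=> x Bx; apply: noB; left.
have [|m' [c' fE]] := fa (g a) (g b).
  move=> y By; have := noB (g' y).
  rewrite -(orientation_preserving_lt go a) -(orientation_preserving_lt go _ b).
  rewrite g'K.
  by apply; right; exists y.
exists (m' * m), (m' * c + c') => x axb /=.
by rewrite fE ?(orientation_preserving_le go)// gE// mulrDr mulrA addrA.
Qed.

Lemma is_PLo_inv f g : is_PLo f -> cancel f g -> cancel g f -> is_PLo g.
Proof.
move=> [[f' [fK f'K fc f'c]] fo [B [finB fa]]] fgK gfK.
have -> : g = f' by apply/funext => x; rewrite -[x in RHS]gfK fK.
have f'lt : orientation_preserving f'.
  by move=> x y xy; rewrite -(orientation_preserving_lt fo) !f'K.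
split => //; first by exists f.
exists (f @` B); split; first exact: finite_image.
move=> a b noB; have [|m [c fE]] := fa (f' a) (f' b).
  move=> x Bx.
  rewrite -(orientation_preserving_lt fo (f' a)).
  rewrite -(orientation_preserving_lt fo x) !f'K.
  by apply: noB; exists x.
have [m0|m0] := eqVneq m 0.
  have [ba|ab] := ltP (val b) (val a).
    exists 0, 0 => x /andP[ax xb]; have := lt_le_trans ba (le_trans ax xb).
    by rewrite ltxx.
  exists 0, (val (f' a)) => x /andP[ax xb]; rewrite mul0r add0r.
  have fE' (y : unit_itv) : val a <= val y <= val b -> val y = c.
    move=> ayb; have := fE (f' y).
    by rewrite !(orientation_preserving_le f'lt) f'K m0 mul0r add0r; apply.
  congr (val (f' _)); apply: val_inj.
  by rewrite [LHS]fE' ?ax// [RHS]fE' ?lexx.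
exists m^-1, (- (m^-1 * c)) => x axb.
have := fE (f' x); rewrite !(orientation_preserving_le f'lt) f'K => ->//.
by rewrite mulrDr mulKf// addrK.
Qed.

Definition PLo_one : PLo := MkPLo is_PLo_id.

Definition PLo_mul (f g : PLo) : PLo :=
  MkPLo (is_PLo_comp (PLoP f) (PLoP g)).

Lemma PLo_has_inv (f : PLo) :
  exists g : PLo, cancel f g /\ cancel g f.
Proof.
case: (f) => h /= hP; have [[g [hK gK _ _]] _ _] := hP.
by exists (MkPLo (is_PLo_inv hP hK gK)).
Qed.

Definition PLo_inv (f : PLo) : PLo := projT1 (cid (PLo_has_inv f)).

Lemma PLo_invK (f : PLo) : cancel f (PLo_inv f).
Proof. by rewrite /PLo_inv; case: cid => g []. Qed.

Lemma PLo_invKV (f : PLo) : cancel (PLo_inv f) f.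
Proof. by rewrite /PLo_inv; case: cid => g []. Qed.

Lemma PLo_mulA : associative PLo_mul.
Proof. by move=> f g h; exact: PLo_inj. Qed.

Lemma PLo_mul1 : left_id PLo_one PLo_mul.
Proof. by move=> f; exact: PLo_inj. Qed.

Lemma PLo_mulr1 : right_id PLo_one PLo_mul.
Proof. by move=> f; exact: PLo_inj. Qed.

Lemma PLo_mulV : left_inverse PLo_one PLo_inv PLo_mul.
Proof. by move=> f; apply/PLo_inj/funext => x /=; exact: PLo_invK. Qed.

Lemma PLo_mulrV : right_inverse PLo_one PLo_inv PLo_mul.
Proof. by move=> f; apply/PLo_inj/funext => x /=; exact: PLo_invKV. Qed.

HB.instance Definition _ :=
  isGroup.Build PLo PLo_mulA PLo_mul1 PLo_mulr1 PLo_mulV PLo_mulrV.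

End PiecewiseLinear.

(* Main.v *)
Require Import Defs.
From HB Require Import structures.
From mathcomp Require Import all_boot all_order all_algebra.
From mathcomp Require Import all_classical all_reals all_analysis.
From mathcomp Require Import zify ring lra.

(* Fix n. If Gamma is not solvable, an element of a deep derived subgroup
   moves some point p. Elements of a derived subgroup have trivial germs
   at the ends of the convex hull of the orbit of p, so the successive
   derived subgroups yield a tower of groups G_0 > G_1 > ... acting near
   p, where the support of (finitely generated) G_(i+1) is compact in the
   hull O_i of the G_i-orbit of p and is displaced by all nontrivial powers
   of some element of G_i. As in iterated wreath products, a tower of height d has
   tuples of elements violating any given finite set of laws with at most
   d syllables.

   Let b be the right end of O_0 and let phi f be the logarithm of the
   slope of f at b. Multiplying the generators of Gamma by large powers of
   one fixed element gives generators x_i for which the values of phi on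
   words of length at most 2n are either 0 or very large. Near b these
   words act linearly, so that they move a suitable copy of the support of
   G_1 off itself unless their slope at b is 1. Let t be a product of
   independent elements of G_1, one on each of these translates. For
   sufficiently spaced exponents c_i, the generating set formed by t and
   the t^c_i x_i t^c_i has no relation of length at most n: a reduced word
   becomes t^m_0 x^(+-1) t^m_1 x^(+-1) ... with all m_j nonzero, and since
   every x_i changes the translate, the corresponding word in the elements
   of G_1 is reduced and has at most n + 1 syllables. *)

Set Implicit Arguments.
Unset Strict Implicit.
Unset Printing Implicit Defensive.

Import Order.TTheory GRing.Theory Num.Theory.

Local Open Scope classical_set_scope.
Local Open Scope ring_scope.

Local Notation gens s := (generated [set` s]).

(** * Subgroups, generating sets and integer powers *)

Section Groups.
Local Open Scope group_scope.
Variable G : groupType.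
Implicit Types (H K S : set G) (s : seq G) (x y : G).

Lemma subgroupP H : subgroup H <->
  [/\ H 1, forall x y, H x -> H y -> H (x * y) & forall x, H x -> H x^-1].
Proof.
split=> [sH|[H1 HM HV]].
  split; first by have /mem_set := set_mem sH.1; rewrite inE.
    move=> x y /mem_set Hx /mem_set Hy.
    by have := group_closedM sH Hx Hy; rewrite inE.
  by move=> x /mem_set Hx; have := group_closedV sH Hx; rewrite inE.
split; first exact/mem_set.
by move=> x y /set_mem Hx /set_mem Hy; apply/mem_set/HM => //; exact: HV.
Qed.

Lemma subgroup1 H : subgroup H -> H 1.
Proof. by case/subgroupP. Qed.

Lemma subgroupM H x y : subgroup H -> H x -> H y -> H (x * y).
Proof. by case/subgroupP=> _ + _; exact. Qed.

Lemma subgroupV H x : subgroup H -> H x -> H x^-1.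
Proof. by case/subgroupP=> _ _; exact. Qed.

Lemma subgroupX H x n : subgroup H -> H x -> H (x ^+ n).
Proof.
move=> sH Hx; elim: n => [|n IH]; first exact: subgroup1.
by rewrite expgS; exact: subgroupM.
Qed.

Lemma subgroup_prod H (I : eqType) (r : seq I) (F : I -> G) : subgroup H ->
  (forall i, i \in r -> H (F i)) -> H (\prod_(i <- r) F i).
Proof.
move=> sH; elim: r => [|i r IH] HF; first by rewrite big_nil; exact: subgroup1.
rewrite big_cons; apply: subgroupM => //; first by apply: HF; rewrite mem_head.
by apply: IH => j jr; apply: HF; rewrite inE jr orbT.
Qed.

Lemma generated_subgroup S : subgroup (generated S).
Proof.
apply/subgroupP; split=> [A [sA _]|x y gx gy A A'|x gx A A'].
- exact: subgroup1.
- by apply: (subgroupM A'.1); [exact: gx|exact: gy].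
- by apply: (subgroupV A'.1); exact: gx.
Qed.

Lemma generated_sub S H : subgroup H -> S `<=` H -> generated S `<=` H.
Proof. exact: smallest_sub. Qed.

Lemma sub_generated S : S `<=` generated S.
Proof. exact: sub_gen_smallest. Qed.

Lemma generatedS S S' : S `<=` S' -> generated S `<=` generated S'.
Proof.
move=> SS'; apply: generated_sub; first exact: generated_subgroup.
exact: subset_trans SS' (@sub_generated _).
Qed.

Lemma derivedS H K : H `<=` K -> derived H `<=` derived K.
Proof.
move=> HK; apply: generatedS => _ [x Hx [y Hy <-]].
by exists x; [exact: HK|exists y; [exact: HK|]].
Qed.

Lemma derived_sub H : subgroup H -> derived H `<=` H.
Proof.
move=> sH; apply: generated_sub => // _ [x Hx [y Hy <-]].
rewrite /commg /conjg.
by do ?[apply: subgroupM => //|apply: subgroupV => //].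
Qed.

Lemma iter_derived_subgroup n H :
  subgroup H -> subgroup (iter n (@derived G) H).
Proof. by move=> sH; case: n => [|n] //=; exact: generated_subgroup. Qed.

(** Each element of a derived subgroup involves only finitely many commutators. This allows every
    storey of a tower to be generated by a finite list. *)
Lemma derived_finitary H (s : seq G) : (forall x, x \in s -> derived H x) ->
  exists2 r : seq G, (forall x, x \in r -> H x) &
    forall x, x \in s -> derived (gens r) x.
Proof.
elim: s => [|x s IH] ds; first by exists [::].
have [r rH rs] : exists2 r : seq G, (forall x, x \in r -> H x) &
    forall x, x \in s -> derived (gens r) x.
  by apply: IH => y ys; apply: ds; rewrite inE ys orbT.
suff [r' r'H r'x] : exists2 r : seq G, (forall x, x \in r -> H x) &
    derived (gens r) x.
  exists (r' ++ r) => [y|y].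
    by rewrite mem_cat => /orP[/r'H|/rH].
  rewrite inE => /predU1P[->|/rs].
    apply: derivedS r'x; apply: generatedS => z /= zr.
    by rewrite mem_cat zr.
  by apply: derivedS; apply: generatedS => z /= zr; rewrite mem_cat zr orbT.
have : derived H x by apply: ds; rewrite mem_head.
set P := [set x | exists2 r : seq G, (forall x, x \in r -> H x) &
  derived (gens r) x].
have mono r1 r2 y : derived (gens r1) y -> derived (gens (r1 ++ r2)) y.
  by apply: derivedS; apply: generatedS => z /= zr; rewrite mem_cat zr.
have mono' r1 r2 y : derived (gens r2) y -> derived (gens (r1 ++ r2)) y.
  by apply: derivedS; apply: generatedS => z /= zr; rewrite mem_cat zr orbT.
rewrite -[exists2 _, _ & _]/(P x); apply: generated_sub.
  apply/subgroupP; split=> [|y z [r1 H1 y1] [r2 H2 z2]|y [r1 H1 y1]].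
  - by exists [::]; [move=> u|exact: (subgroup1 (generated_subgroup _))].
  - exists (r1 ++ r2); first by move=> u; rewrite mem_cat => /orP[/H1|/H2].
    by apply: (subgroupM (generated_subgroup _)); [exact: mono|exact: mono'].
  - by exists r1 => //; apply: (subgroupV (generated_subgroup _)).
move=> _ [y Hy [z Hz <-]]; exists [:: y; z].
  by move=> u; rewrite !inE => /orP[]/eqP->.
apply: sub_generated; exists y; last exists z => //;
  by apply: sub_generated; rewrite /= !inE eqxx ?orbT.
Qed.

Definition zpow x (m : int) : G :=
  match m with Posz n => x ^+ n | Negz n => x ^- n.+1 end.

Lemma zpow_nat x (n : nat) : zpow x n = x ^+ n. Proof. by []. Qed.

Lemma zpow1 x : zpow x 1 = x. Proof. by []. Qed.

Lemma zpowNn x (n : nat) : zpow x (- n%:Z)%R = x ^- n.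
Proof. by case: n => [|n] //=; rewrite expg0 invg1. Qed.

Lemma zpowN x (m : int) : zpow x (- m)%R = (zpow x m)^-1.
Proof.
by case: m => n; rewrite ?zpowNn // NegzE opprK zpowNn zpow_nat invgK.
Qed.

Lemma zpow_succ x (m : int) : zpow x (1 + m)%R = x * zpow x m.
Proof.
case: m => n; first by rewrite -PoszD add1n zpow_nat expgS.
have -> : (1 + Negz n = - n%:Z)%R by rewrite NegzE -addn1 PoszD; ring.
by rewrite zpowNn [zpow _ _]/= expgSr invgM mulVKg.
Qed.

Lemma zpowD x (m n : int) : zpow x (m + n)%R = zpow x m * zpow x n.
Proof.
elim/int_rect: m => [|m IH|m IH]; first by rewrite add0r mul1g.
  have -> : (m.+1%:Z + n = 1 + (m%:Z + n))%R by rewrite -addn1 PoszD; ring.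
  by rewrite zpow_succ IH mulgA -zpow_succ addrC -PoszD addn1.
apply: (@mulgI _ x); rewrite mulgA -!zpow_succ.
have -> : (1 - m.+1%:Z = - m%:Z)%R by rewrite -addn1 PoszD; ring.
by rewrite -IH -addn1 PoszD; congr (zpow x _); ring.
Qed.

Lemma subgroup_zpow H x m : subgroup H -> H x -> H (zpow x m).
Proof.
move=> sH Hx; case: m => n; rewrite /zpow; last apply: subgroupV => //;
  exact: subgroupX.
Qed.

End Groups.

(** * Real-valued homomorphisms on a subgroup *)

Section Hom.
Variables (R : realType) (T : groupType) (G : set T) (phi : T -> R).
Hypotheses (sG : subgroup G)
  (phiM : forall f g, G f -> G g -> phi (f * g)%g = phi f + phi g).

Lemma hom1 : phi 1%g = 0.
Proof.
have := phiM (subgroup1 sG) (subgroup1 sG); rewrite mulg1 => e.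
by apply: (@addrI _ (phi 1%g)); rewrite -e addr0.
Qed.

Lemma homV f : G f -> phi f^-1%g = - phi f.
Proof.
move=> Gf; apply: (@addrI _ (phi f)).
by rewrite -phiM ?mulgV ?hom1 ?subrr//; exact: subgroupV.
Qed.

Lemma homX f n : G f -> phi (f ^+ n)%g = phi f *+ n.
Proof.
move=> Gf; elim: n => [|n IH]; first by rewrite expg0 hom1.
by rewrite expgS phiM ?IH ?mulrS//; exact: subgroupX.
Qed.

(** Commutators vanish in the additive group of [R]. For the logarithm of the slope at a common
    fixed point, this makes the germs of derived elements trivial. *)
Lemma hom_derived f : derived G f -> phi f = 0.
Proof.
suff : derived G `<=` [set f | G f /\ phi f = 0] by move=> /[apply] -[].
apply: generated_sub.
  apply/subgroupP; split => /=.
  - by split; [exact: subgroup1|exact: hom1].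
  - move=> x y [Gx x0] [Gy y0]; split; first exact: subgroupM.
    by rewrite phiM// x0 y0 addr0.
  - by move=> x [Gx x0]; split; [exact: subgroupV|rewrite homV// x0 oppr0].
move=> _ [x Gx [y Gy <-]] /=.
have GV f' : G f' -> G f'^-1%g by exact: subgroupV.
have GM f' g' : G f' -> G g' -> G (f' * g')%g by exact: subgroupM.
rewrite commgEl conjgE; split; first by auto.
by rewrite !phiM ?homV//; auto; ring.
Qed.

End Hom.

(** * Words acting on translates of a set *)

Section Action.
Variable R : realType.
Local Notation P := (PLo R).
Local Notation X := (unit_itv R).
Implicit Types (f g h u : P) (x y z : X) (G H : set P) (O K : set X).

Lemma PLoM f g x : (f * g)%g x = f (g x). Proof. by []. Qed.

Lemma PLoKV f : cancel f (f^-1)%g. Proof. exact: PLo_invK. Qed.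

Lemma PLoVK f : cancel (f^-1)%g f. Proof. exact: PLo_invKV. Qed.

Definition preserves O f := forall x, O x -> O (f x).

Lemma preserves_zpow O f m :
  preserves O f -> preserves O (f^-1)%g -> preserves O (zpow f m).
Proof.
move=> fO f'O x Ox; case: m => n; rewrite /zpow -?expVgn.
  by elim: n => // n IH; rewrite expgS; exact: fO.
by elim: n.+1 => // k IH; rewrite expgS; exact: f'O.
Qed.

Lemma preserves_syllables (I : Type) (e : I -> P) w O :
  (forall i, preserves O (e i)) -> (forall i, preserves O (e i)^-1%g) ->
  preserves O (\prod_(l <- w) zpow (e l.1) l.2)%g.
Proof.
move=> eO e'O x Ox; elim: w => [|l w IH]; first by rewrite big_nil.
by rewrite big_cons; exact: preserves_zpow.
Qed.

(** Positive powers follow by iteration inside [O]. For negative ones the relation is applied at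
    [e^-1 y], which again lies in [O]; [u] itself may move [O] elsewhere. *)
Lemma zpow_intertwine O (E e u : P) : preserves O e -> preserves O (e^-1)%g ->
  (forall y, O y -> E (u y) = u (e y)) ->
  forall m y, O y -> zpow E m (u y) = u (zpow e m y).
Proof.
move=> eO e'O Eu m.
have Xn f g n : preserves O f -> (forall y, O y -> g (u y) = u (f y)) ->
    forall y, O y -> (g ^+ n)%g (u y) = u ((f ^+ n)%g y).
  move=> fO gu; elim: n => // n IH y Oy.
  by rewrite !expgSr !PLoM gu// IH//; exact: fO.
case: m => n; first exact: Xn.
rewrite /zpow -!expVgn; apply: Xn => // y Oy.
by rewrite -[y in LHS](PLoVK e) -Eu ?PLoKV//; exact: e'O.
Qed.

Definition syllables_eval (I : Type) (e : I -> P) (w : seq (I * int)) : P :=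
  (\prod_(l <- w) zpow (e l.1) l.2)%g.

Section Walk.
Variables (I V : Type) (p : P -> V).
Implicit Types (s : seq (P + I * int)).

(** A step [inl u] is a mover, which carries a set to a new place; a step [inr (i, m)] is meant to
    act inside the current place. *)
Definition steps_eval (E : I -> P) s : P :=
  (\prod_(c <- s) match c with inl u => u | inr l => zpow (E l.1) l.2 end)%g.

Definition displacement s : P :=
  (\prod_(c <- s) match c with inl u => u | inr _ => 1 end)%g.

(* Each syllable is relabelled by the image under [p] of the place to which the
   movers on its right take the starting set. *)
Fixpoint emission s : seq (I * V * int) :=
  match s with
  | [::] => [::]
  | inl _ :: s => emission s
  | inr l :: s => (l.1, p (displacement s), l.2) :: emission s
  end.

Fixpoint visited s : seq P :=
  match s with
  | [::] => [::]
  | inl _ :: s => visited s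
  | inr l :: s => displacement s :: visited s
  end.

Lemma displacement_inl u s : displacement (inl u :: s) = (u * displacement s)%g.
Proof. by rewrite /displacement big_cons. Qed.

Lemma displacement_inr l s : displacement (inr l :: s) = displacement s.
Proof. by rewrite /displacement big_cons mul1g. Qed.

(** Read from the right, the movers carry [g O] from place to place, and at the place [u] the letter
    [E i] acts as the copy of [e (i, p u)]. Pulling all syllables back to [O] gives the emitted
    word. Later [p] is the identity for powers of [h], and the logarithm of the slope near an
    end. *)
Lemma walk (E : I -> P) (e : I * V -> P) (g : P) O s :
  (forall c, preserves O (e c)) -> (forall c, preserves O (e c)^-1%g) ->
  (forall i u, u \in visited s ->
    forall y, O y -> E i (u (g y)) = u (g (e (i, p u) y))) ->
  forall y, O y ->
    steps_eval E s (g y) = displacement s (g (syllables_eval e (emission s) y)).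
Proof.
move=> eO e'O; elim: s => [|[u|l] s IH] Es y Oy.
- by rewrite /steps_eval /displacement /syllables_eval !big_nil.
- rewrite displacement_inl /steps_eval big_cons !PLoM -IH//.
have Oz : O (syllables_eval e (emission s) y).
  exact: (preserves_syllables (emission s) eO e'O).
rewrite displacement_inr /steps_eval big_cons PLoM -/(steps_eval E s) IH//;
  last first.
  by move=> i u us; apply: Es; rewrite inE us orbT.
rewrite /= /syllables_eval big_cons PLoM.
have := @zpow_intertwine O (E l.1) (e (l.1, p (displacement s)))
  (displacement s * g)%g (eO _) (e'O _).
by apply=> // {Oz y Oy} y Oy; rewrite !PLoM Es// mem_head.
Qed.

End Walk.

(** The factor of index [i] fixes [r v x] for [v] other than [i]: the point [(r i)^-1 (r v x)] lies
    in [O] but, the translates of [K] being disjoint, not in [K], so [e i] fixes it. *)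
Lemma glue_translates (V : eqType) (vs : seq V) (r e : V -> P) O K :
  (forall v, v \in vs -> preserves O (r v)) ->
  (forall v, v \in vs -> preserves O (r v)^-1%g) ->
  K `<=` O -> (forall v, preserves K (e v)) ->
  (forall v x, O x -> ~ K x -> e v x = x) -> uniq vs ->
  (forall v v' x y, v \in vs -> v' \in vs -> K x -> K y -> r v x = r v' y ->
    v = v') ->
  forall v x, v \in vs -> K x ->
    (\prod_(i <- vs) (r i * e i * (r i)^-1))%g (r v x) = r v (e v x).
Proof.
move=> rO r'O KO eK eO vsu dis.
have skip (us : seq V) v x :
    {subset us <= vs} -> v \in vs -> v \notin us -> K x ->
    (\prod_(i <- us) (r i * e i * (r i)^-1))%g (r v x) = r v x.
  elim: us => [|u us IH] usv vvs; first by rewrite big_nil.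
  rewrite inE negb_or => /andP[vu vus] Kx.
  have uvs : u \in vs by apply: usv; rewrite mem_head.
  rewrite big_cons PLoM IH//; last first.
    by move=> j jus; apply: usv; rewrite inE jus orbT.
  rewrite !PLoM eO ?PLoVK//.
    by apply: r'O => //; apply: rO => //; exact: KO.
  move=> Ky; have /eqP := dis v u x _ vvs uvs Kx Ky (esym (PLoVK _ _)).
  by rewrite (negbTE vu).
move=> v x; have : {subset vs <= vs} by [].
elim: {-3}vs vsu => [//|u us IH] /= /andP[uus usu] usv.
have usv' : {subset us <= vs} by move=> j jus; apply: usv; rewrite inE jus orbT.
rewrite inE big_cons => /predU1P[->|vus] Kx; rewrite PLoM.
  by rewrite skip//; [rewrite !PLoM PLoKV|apply: usv; rewrite mem_head].
rewrite IH//; have := skip [:: u] v (e v x).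
rewrite big_seq1; apply.
- by move=> j; rewrite inE => /eqP->; apply: usv; rewrite mem_head.
- exact: usv'.
- by rewrite inE; apply: contraNneq uus => <-.
- exact: eK.
Qed.

End Action.

(** * Towers and the laws they violate *)

Section Tower.
Variable R : realType.
Local Notation P := (PLo R).
Local Notation X := (unit_itv R).
Implicit Types (f g h u : P) (x y z : X) (G H : set P) (O K : set X).

(** The translates of [K] by the powers of [h] are disjoint, so [G] contains conjugates of [G1]
    acting on them independently, as in a wreath product. Elements of [G1] are only controlled
    inside [O], hence the identity is required on [O] minus [K] alone. *)
Fixpoint tower d G O : Prop :=
  [/\ subgroup G, O !=set0, (forall g, G g -> preserves O g) &
  match d with
  | 0 => True
  | d'.+1 => exists G1 O1 K h,
      [/\ G1 `<=` G, G h, O1 `<=` K, K `<=` O &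
      [/\ forall g x, G1 g -> O x -> ~ K x -> g x = x,
          forall m x, K x -> ~ K ((h ^+ m.+1)%g x) &
          tower d' G1 O1]]
  end].

Lemma tower_subgroup d G O : tower d G O -> subgroup G.
Proof. by case: d => [|d] []. Qed.

Lemma tower_nonempty d G O : tower d G O -> O !=set0.
Proof. by case: d => [|d] []. Qed.

Lemma tower_preserves d G O g : tower d G O -> G g -> preserves O g.
Proof. by case: d => [|d] [_ _ + _]; exact. Qed.

Lemma preserves_support g O K : K `<=` O -> preserves O g ->
  (forall x, O x -> ~ K x -> g x = x) -> preserves K g.
Proof.
move=> KO gO gK x Kx; have [//|nK] := pselect (K (g x)).
have /(congr1 (g^-1)%g) := gK _ (gO _ (KO _ Kx)) nK.
by rewrite !PLoKV => e; move: nK; rewrite e.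
Qed.

Lemma zpow_separated h K a b x y :
  (forall m z, K z -> ~ K ((h ^+ m.+1)%g z)) ->
  K x -> K y -> zpow h a x = zpow h b y -> a = b.
Proof.
move=> hK; wlog ab : a b x y / a <= b => [wl Kx Ky e|].
  case/orP: (le_total a b) => ab; first exact: wl e.
  by apply/esym; exact: (wl b a y x).
move=> Kx Ky e; apply/eqP; rewrite eq_le ab /= leNgt; apply/negP => ab'.
have [n nE] : exists n : nat, b - a = n.+1%:Z.
  by exists `|b - a|.-1%N; lia.
apply: (hK n y Ky); rewrite -zpow_nat -nE addrC zpowD PLoM -e -PLoM -zpowD.
by rewrite addNr.
Qed.

Section Steps.
Variables (I : eqType) (j : I) (h : P).
Implicit Types w : seq (I * int).

Let steps w : seq (P + I * int) :=
  [seq if l.1 == j then inl (zpow h l.2) else inr l | l <- w].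

Lemma displacement_steps w : exists a, displacement (steps w) = zpow h a.
Proof.
elim: w => [|l w [a IH]]; first by exists 0; rewrite /displacement big_nil.
rewrite /steps map_cons; case: ifP => _.
  by exists (l.2 + a); rewrite displacement_inl IH zpowD.
by exists a; rewrite displacement_inr IH.
Qed.

Lemma visited_steps w u : u \in visited (steps w) -> exists a, u = zpow h a.
Proof.
elim: w => //= l w IH; case: ifP => _ //=.
by rewrite inE => /predU1P[->|//]; exact: displacement_steps.
Qed.

Lemma steps_evalE E w :
  steps_eval E (steps w) =
  syllables_eval (fun i => if i == j then h else E i) w.
Proof.
rewrite /steps_eval /syllables_eval big_map; apply: eq_bigr => l _.
by case: ifP.
Qed.

Lemma size_emission (V : Type) (p : P -> V) w :
  (size (emission p (steps w)) <= size w)%N.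
Proof.
by elim: w => //= l w IH; case: ifP => _ /=; [exact: leq_trans IH _|].
Qed.

Lemma emission_nz (V : Type) (p : P -> V) w :
  all (fun l => l.2 != 0) w -> all (fun l => l.2 != 0) (emission p (steps w)).
Proof.
by elim: w => //= l w IH /andP[nz /IH aw]; case: ifP => _ //=; rewrite nz.
Qed.

Hypothesis hinf : forall a, a != 0 -> zpow h a <> 1%g.

(** Syllables with the same letter become neighbours only when exactly one syllable of [j] stood
    between them. That syllable is a nontrivial power of [h], so their places differ. *)
Lemma emission_sorted w : all (fun l => l.2 != 0) w ->
  sorted (fun l l' => l.1 != l'.1) w ->
  sorted (fun l l' => l.1 != l'.1) (emission id (steps w)).
Proof.
elim: w => //= l w IH /andP[_ nz] lw.
have {IH} := IH nz (path_sorted lw).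
case: ifP => //= /negbT lj.
case: w lw nz => //= l' w /andP[ll' l'w] /andP[nz' nz].
case: ifP => /= [/eqP l'j|_ -> /=]; last first.
  by rewrite andbT; apply: contra ll' => /eqP[->].
case: w l'w nz => //= l'' w /andP[l'l'' _] _.
rewrite -l'j eq_sym (negbTE l'l'') /= => ->; rewrite andbT.
apply/eqP => -[_]; rewrite displacement_inl displacement_inr.
by rewrite -[X in _ = X]mul1g => /mulIg; exact: hinf.
Qed.

Lemma emission_nil w (m : int) :
  sorted (fun l l' => l.1 != l'.1) ((j, m) :: w) ->
  emission id (steps ((j, m) :: w)) = [::] -> w = [::].
Proof.
case: w => //= l w /andP[jl _]; rewrite eqxx /=.
by rewrite eq_sym (negbTE jl).
Qed.

End Steps.

(* Turn one letter [j] of the word into the displacing element [h] of the tower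
   and every other letter into a product of elements of the next storey, placed
   independently on the translates of [K] by the powers of [h]: the word then
   either moves [K] off itself or acts on [K] as a shorter word in the elements
   of the next storey. *)
Lemma tower_no_law d (I : eqType) (w : seq (I * int)) G O :
  tower d G O -> w <> [::] -> all (fun l => l.2 != 0) w ->
  sorted (fun l l' => l.1 != l'.1) w -> (size w <= d)%N ->
  exists2 e : I -> P, (forall i, G (e i)) &
    exists2 y, O y & syllables_eval e w y <> y.
Proof.
elim: d I w G O => [|d IH] I w G O; first by case: w.
case=> sG _ GO [G1] [ O1] [K] [h] [G1G Gh O1K KO] [G1K hK tw].
case: w => // -[j m] w _ nz sw sizew; have /andP[m0 _] := nz.
pose st (w : seq (I * int)) : seq (P + I * int) :=
  [seq if l.1 == j then inl (zpow h l.2) else inr l | l <- w].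
have [y0 O1y0] := tower_nonempty tw.
have hinf a : a != 0 -> zpow h a <> 1%g.
  move=> a0 /(congr1 (fun f : P => f y0)) e.
  have Ky0 := O1K _ O1y0.
  have := @zpow_separated h K a 0 y0 y0 hK Ky0 Ky0 e.
  by move/eqP; rewrite (negbTE a0).
have [a aE] := displacement_steps j h ((j, m) :: w).
(* If the total exponent of [h] is nonzero, all letters other than [j] can be made trivial: the word
   becomes [h^a], which moves [y0] out of [K]. *)
have [a0|a0] := eqVneq a 0; last first.
  exists (fun i => if i == j then h else 1%g).
    by move=> i; case: ifP => // _; exact: subgroup1.
  exists y0; first exact/KO/O1K.
  rewrite -(steps_evalE j h (fun=> 1%g)).
  have -> : steps_eval (fun=> 1%g) (st ((j, m) :: w)) = zpow h a.
    rewrite -aE; apply: eq_bigr => -[//|l] _.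
    by case: l.2 => n; rewrite /zpow expg1n ?invg1.
  have Ky0 := O1K _ O1y0.
  move=> e; have := @zpow_separated h K a 0 y0 y0 hK Ky0 Ky0 e.
  by move/eqP; rewrite (negbTE a0).
set s := st ((j, m) :: w) in aE *.
have [||||e' eG1 [y O1y ey]] := IH (I * P)%type (emission id s) G1 O1 tw.
(* With no emitted syllable the word is a single power of [j], whose displacement [h^m] is not
   trivial, contrary to [a = 0]. *)
- move=> /(emission_nil sw) w0; move: aE.
  rewrite /s w0 a0 /st /= eqxx displacement_inl /displacement big_nil mulg1.
  exact: hinf.
- exact: emission_nz.
- exact: emission_sorted.
- by rewrite /s /st /= eqxx /= (leq_trans (size_emission _ _ _ _)).
pose vs := undup (visited s).
have vsG v : v \in vs -> G v.
  by rewrite mem_undup => /visited_steps[b ->]; exact: subgroup_zpow.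
have sG1 := tower_subgroup tw.
pose E i := (\prod_(v <- vs) (v * e' (i, v) * v^-1))%g.
exists (fun i => if i == j then h else E i).
  move=> i; case: ifP => // _; apply: subgroup_prod => // v /vsG Gv.
  apply: subgroupM => //; last exact: subgroupV.
  by apply: subgroupM => //; exact: G1G.
exists y; first exact/KO/O1K.
rewrite -steps_evalE -/(st _) -/s.
have := @walk R I P id E e' 1%g O1 s.
rewrite -[X in _ <> X](_ : displacement s y = y); last by rewrite aE a0.
have e'K i : preserves K (e' i).
  apply: (preserves_support KO); first exact/GO/G1G.
  by move=> x; exact: G1K.
move=> -> //.
- by move=> /(can_inj (PLoKV _)); exact: ey.
- by move=> c; exact: (tower_preserves tw).
- by move=> c; apply: (tower_preserves tw); exact: subgroupV.
move=> i u us x O1x.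
apply: (@glue_translates R P vs id (fun v => e' (i, v)) O K) => //.
- by move=> v /vsG; exact: GO.
- by move=> v /vsG Gv; apply: GO; exact: subgroupV.
- by move=> v z; exact: G1K.
- exact: undup_uniq.
- move=> v v' z z'; rewrite !mem_undup.
  move=> /visited_steps[b ->] /visited_steps[b' ->] Kz Kz'.
  by move=> /(zpow_separated hK Kz Kz') ->.
- by rewrite mem_undup.
- exact: O1K.
Qed.

(** One extra storey serves all words at once: a tuple violating the word [w] is placed on the
    translate of [K] by the power of [h] whose exponent is the index of [w], and the tuples are
    glued. *)
Lemma tower_no_laws d (I : eqType) (ws : seq (seq (I * int))) G O :
  tower d.+1 G O ->
  (forall w, w \in ws -> [/\ w <> [::], all (fun l => l.2 != 0) w,
     sorted (fun l l' => l.1 != l'.1) w & (size w <= d)%N]) ->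
  exists2 e : I -> P, (forall i, G (e i)) &
    forall w, w \in ws -> exists2 y, O y & syllables_eval e w y <> y.
Proof.
move=> [sG _ GO [G1 [ O1 [K [h [G1G Gh O1K KO [G1K hK tw]]]]]]] wsP.
have {wsP} wsP w : exists e : I -> P, (forall i, G1 (e i)) /\
    (w \in ws -> exists2 y, O1 y & syllables_eval e w y <> y).
  have sG1 := tower_subgroup tw.
  have [/wsP[w1 w2 w3 w4]|_] := boolP (w \in ws); last first.
    by exists (fun=> 1%g); split => // _; exact: subgroup1.
  by have [e eG1 ey] := tower_no_law tw w1 w2 w3 w4; exists e.
have {wsP} [e eP] := choice wsP.
have hG a : G (zpow h a) by exact: subgroup_zpow.
pose r w := zpow h (index w ws)%:Z.
pose E i := (\prod_(w <- undup ws) (r w * e w i * (r w)^-1))%g.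
exists E.
  move=> i; apply: subgroup_prod => // w _.
  apply: (subgroupM sG); last exact: subgroupV sG (hG _).
  by apply: (subgroupM sG); [exact: hG|apply: G1G; exact: (eP w).1].
move=> w wws; have [y O1y ey] := (eP w).2 wws.
exists (r w y); first by apply: (GO _ (hG _)); exact/KO/O1K.
have eK v i : preserves K (e v i).
  apply: (preserves_support KO).
    by apply: GO; apply: G1G; exact: (eP v).1.
  by move=> x; apply: G1K; exact: (eP v).1.
have EE i x : O1 x -> E i (r w x) = r w (e w i x).
  move=> O1x.
  apply: (@glue_translates R _ (undup ws) r (fun v => e v i) O K) => //.
  - by move=> v _; apply: GO; exact: hG.
  - by move=> v _; apply: GO; exact: subgroupV sG (hG _).
  - by move=> v z; apply: G1K; exact: (eP v).1.
  - exact: undup_uniq.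
  - move=> v v' z z'; rewrite !mem_undup => vws v'ws Kz Kz'.
    move=> /(zpow_separated hK Kz Kz') [] /(congr1 (nth [::] ws)).
    by rewrite !nth_index.
  - by rewrite mem_undup.
  - exact: O1K.
have eO v i : preserves O1 (e v i).
  by apply: (tower_preserves tw); exact: (eP v).1.
have e'O v i : preserves O1 (e v i)^-1%g.
  apply: (tower_preserves tw); apply: (subgroupV (tower_subgroup tw)).
  exact: (eP v).1.
suff -> : syllables_eval E w (r w y) = r w (syllables_eval (e w) w y).
  by move=> /(can_inj (PLoKV _)); exact: ey.
rewrite /syllables_eval; elim: {1 4}w => [|l v IH]; first by rewrite !big_nil.
rewrite !big_cons !PLoM IH; apply: (zpow_intertwine (eO w l.1)) => //.
- by move=> z; exact: EE.
- exact: (preserves_syllables v (eO w) (e'O w)).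
Qed.

End Tower.

(** * Germs at the ends of an orbit, and towers in derived subgroups *)

Section Germs.
Variable R : realType.
Local Notation P := (PLo R).
Local Notation X := (unit_itv R).
Implicit Types (f g h u : P) (x y z e p : X) (G H : set P) (O K : set X).
Implicit Types (b : bool) (a d : R).

Lemma PLo_le f x y : (val (f x) <= val (f y)) = (val x <= val y).
Proof. by apply: orientation_preserving_le; case: (PLoP f). Qed.

Lemma PLo_lt f x y : (val (f x) < val (f y)) = (val x < val y).
Proof. by apply: orientation_preserving_lt; case: (PLoP f). Qed.

(* Distance to [e], positive to the left of [e] if [b = false] and to the right
   if [b = true]. *)
Definition gap b e x : R := (-1) ^+ b * (val e - val x).

Lemma gap_self b e : gap b e e = 0.
Proof. by rewrite /gap subrr mulr0. Qed.

Lemma gap_inj b e : injective (gap b e).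
Proof.
move=> x y; rewrite /gap => /(congr1 ( *%R ((-1) ^+ b))).
by rewrite !signrMK => /addrI /oppr_inj /val_inj.
Qed.

Lemma gap_le b e f x y :
  (gap b e (f x) <= gap b e (f y)) = (gap b e x <= gap b e y).
Proof.
rewrite /gap; case: b; rewrite ?expr0 ?expr1 ?mul1r ?mulN1r;
  by rewrite !(lerN2, lerD2l) PLo_le.
Qed.

Lemma gap_lt b e f x y :
  (gap b e (f x) < gap b e (f y)) = (gap b e x < gap b e y).
Proof. by rewrite !ltNge gap_le. Qed.

Lemma finite_gap b e (s : seq X) :
  exists2 d, 0 < d & forall x, x \in s -> 0 < gap b e x -> d <= gap b e x.
Proof.
elim: s => [|x s [d d0 sd]]; first by exists 1.
have [x0|x0] := ltP 0 (gap b e x).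
  exists (Order.min d (gap b e x)); first by rewrite lt_min d0.
  move=> y; rewrite inE => /predU1P[-> _|ys y0]; rewrite ge_min ?lexx ?orbT//.
  by rewrite sd.
exists d => // y; rewrite inE => /predU1P[->|]; last exact: sd.
by rewrite ltNge x0.
Qed.

(** The one-sided slope at the fixed point [e] is written [expR a], so that [a] is additive under
    composition. *)
Definition germ b e f a := exists2 d, 0 < d &
  forall x, 0 <= gap b e x <= d -> gap b e (f x) = expR a * gap b e x.

Lemma germ_exists b e f : f e = e -> exists a, germ b e f a.
Proof.
move=> fe; have [_ _ [B [/finite_seqP[s ->] fa]]] := PLoP f.
have [d d0 sd] := finite_gap b e s.
(* If there is no such [q], then [e] is the end of the unit interval on this side and any value of
   [a] will do. Otherwise no breakpoint lies strictly between [e] and [q]. *)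
have [[q /andP[q0 qd]]|nq] := pselect (exists q, 0 < gap b e q < d); last first.
  exists 0, (d / 2); first by rewrite divr_gt0.
  move=> x /andP[x0 xd]; have [x0'|x0'] := eqVneq (gap b e x) 0.
    have -> : x = e by apply: (@gap_inj b e); rewrite gap_self.
    by rewrite fe gap_self mulr0.
  case: nq; exists x; rewrite lt_neqAle eq_sym x0' x0 /=.
  by apply: le_lt_trans xd _; lra.
have [m [c fE]] : exists m c, forall x, 0 <= gap b e x <= gap b e q ->
    val (f x) = m * val x + c.
  have [|m [c fE]] := fa (if b then e else q) (if b then q else e).
  - move=> x xs; apply/negP => /andP[]; have := sd x xs; move: qd; rewrite /gap.
    by case: (b); rewrite ?expr0 ?expr1 ?mul1r ?mulN1r; lra.
  exists m, c => x x0q; apply: fE; move: x0q; rewrite /gap.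
  by case: (b); rewrite ?expr0 ?expr1 ?mul1r ?mulN1r; lra.
have fgap x : 0 <= gap b e x <= gap b e q -> gap b e (f x) = m * gap b e x.
  move=> xq; have := fE x xq; have := fE e; rewrite gap_self lexx (ltW q0) fe.
  move=> /(_ isT) eE xE; rewrite /gap xE {1}eE; ring.
have m0 : 0 < m.
  have : 0 < gap b e (f q) by rewrite -(gap_self b e) -{2}fe gap_lt gap_self.
  by rewrite fgap ?lexx ?(ltW q0)// pmulr_lgt0.
exists (ln m), (gap b e q) => // x xq.
by rewrite lnK// fgap.
Qed.

Lemma germ_mul b e f g a a' : germ b e f a -> germ b e g a' ->
  germ b e (f * g)%g (a + a').
Proof.
move=> [d d0 fa] [d' d'0 ga'].
exists (Order.min d' (d / expR a')).
  by rewrite lt_min d'0 divr_gt0 ?expR_gt0.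
move=> x /andP[x0]; rewrite le_min ler_pdivlMr ?expR_gt0// => /andP[xd' xd].
have gx := ga' x; rewrite x0 xd' in gx.
rewrite PLoM fa gx//; first by rewrite expRD mulrA.
by rewrite [_ * gap _ _ _]mulrC xd andbT mulr_ge0// expR_ge0.
Qed.

(** This excludes the ends of the unit interval on their outer side, where the slope is not
    determined. *)
Definition approached b e := forall d, 0 < d -> exists x, 0 < gap b e x < d.

Lemma germ_uniq b e f a a' : approached b e ->
  germ b e f a -> germ b e f a' -> a = a'.
Proof.
move=> ne [d d0 fa] [d' d'0 fa'].
have [|x /andP[x0]] := ne (Order.min d d'); first by rewrite lt_min d0.
rewrite lt_min => /andP[xd xd']; apply: expR_inj.
by apply: (@mulIf _ (gap b e x)); [rewrite gt_eqF|rewrite -fa ?fa'// !ltW].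
Qed.

Lemma germ_hom b e G : subgroup G -> (forall g, G g -> g e = e) ->
  approached b e -> exists phi : P -> R,
  (forall f, G f -> germ b e f (phi f)) /\
  (forall f g, G f -> G g -> phi (f * g)%g = phi f + phi g).
Proof.
move=> sG Ge ne.
have /choice[phi phiP] : forall f, exists a, G f -> germ b e f a.
  move=> f; have [Gf|] := pselect (G f); last by exists 0.
  by have [a fa] := germ_exists b (Ge _ Gf); exists a.
exists phi; split => // f g Gf Gg; apply: (germ_uniq ne).
  by apply: phiP; exact: subgroupM.
by apply: germ_mul; exact: phiP.
Qed.

Lemma germ_common b e (us : seq P) (phi : P -> R) :
  (forall u, u \in us -> germ b e u (phi u)) ->
  exists2 d, 0 < d & forall u x, u \in us -> 0 <= gap b e x <= d ->
    gap b e (u x) = expR (phi u) * gap b e x.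
Proof.
elim: us => [|u us IH] uP; first by exists 1.
have [|d d0 dP] := IH; first by move=> v vus; apply: uP; rewrite inE vus orbT.
have [d' d'0 d'P] := uP u (mem_head _ _).
exists (Order.min d d'); first by rewrite lt_min d0.
move=> v x; rewrite inE le_min => /predU1P[->|vus] /and3P[x0 xd xd'].
  by apply: d'P; rewrite x0.
by apply: dP => //; rewrite x0.
Qed.

(** The point [e] is the supremum of the orbit, or its infimum if [b = true]; the sign in [A] turns
    the latter into a supremum. The group permutes the orbit and keeps the order, so it fixes [e].
    An orbit point equal to [e] would force [p = e], but [p] is moved. *)
Lemma orbit_end b G p : subgroup G -> (exists2 f, G f & f p <> p) ->
  exists e, [/\ forall g, G g -> g e = e, forall g, G g -> 0 < gap b e (g p) &
    forall d, 0 < d -> exists2 g, G g & gap b e (g p) < d].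
Proof.
move=> sG [f Gf fp].
have val01 x : 0 <= val x <= 1 by have := set_valP x; rewrite /= in_itv.
pose A := [set (-1) ^+ b * val (g p) | g in G].
have supA : has_sup A.
  split; first by exists ((-1) ^+ b * val p), 1%g => //; exact: subgroup1.
  exists 1 => _ [g _ <-]; have := val01 (g p).
  by case: (b); rewrite ?expr0 ?expr1 ?mul1r ?mulN1r; lra.
have s01 : 0 <= (-1) ^+ b * sup A <= 1.
  have Ap : A ((-1) ^+ b * val p) by exists 1%g => //; exact: subgroup1.
  have := ub_le_sup supA.2 Ap; have := val01 p.
  have : sup A <= if b then 0 else 1.
    apply: ge_sup; first exact: supA.1.
    move=> _ [g _ <-]; have := val01 (g p).
    by case: (b); rewrite ?expr0 ?expr1 ?mul1r ?mulN1r; lra.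
  by case: (b); rewrite ?expr0 ?expr1 ?mul1r ?mulN1r; lra.
have e01 : (-1) ^+ b * sup A \in (`[0, 1]%classic : set R).
  by rewrite inE /= in_itv.
pose e : X := SigSub e01.
have gapE x : gap b e x = sup A - (-1) ^+ b * val x.
  by rewrite /gap mulrBr [val e]/= signrMK.
have gap_ge0 g : G g -> 0 <= gap b e (g p).
  by move=> Gg; rewrite gapE subr_ge0; apply: (ub_le_sup supA.2); exists g.
have gap_near d : 0 < d -> exists2 g, G g & gap b e (g p) < d.
  move=> d0; have [_ [g Gg <-] gd] := sup_adherent d0 supA.
  by exists g => //; rewrite gapE ltrBlDr -ltrBlDl.
have Ge_le g : G g -> gap b e (g e) <= 0.
  move=> Gg; rewrite leNgt; apply/negP => /gap_near[u Gu].
  rewrite -(gap_lt b e g^-1%g) PLoKV gap_self -PLoM ltNge gap_ge0//.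
  by apply: subgroupM => //; exact: subgroupV.
have Ge g : G g -> g e = e.
  move=> Gg; apply: (@gap_inj b e); rewrite gap_self; apply/eqP.
  rewrite eq_le Ge_le//= -(gap_self b e) -(gap_le b e g^-1%g) PLoKV gap_self.
  by apply: Ge_le; exact: subgroupV.
exists e; split => // g Gg; rewrite lt_neqAle gap_ge0// andbT eq_sym.
apply/eqP => g0; apply: fp; have gpe : g p = e.
  by apply: (@gap_inj b e); rewrite gap_self.
have -> : p = e by rewrite -(PLoKV g p) gpe; apply: Ge; exact: subgroupV.
exact: Ge.
Qed.

(** This is the open interval between the infimum and the supremum of the orbit of [p], described
    without naming its ends. *)
Definition hull G p : set X := [set x |
  (exists2 g, G g & val (g p) < val x) /\ (exists2 g, G g & val x < val (g p))].

Definition box x y : set X := [set z | val x <= val z <= val y].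

Lemma hull_preserves G p g : subgroup G -> G g -> preserves (hull G p) g.
Proof.
move=> sG Gg x [[u Gu ux] [v Gv xv]]; split.
  by exists (g * u)%g; [exact: subgroupM|rewrite PLoM PLo_lt].
by exists (g * v)%g; [exact: subgroupM|rewrite PLoM PLo_lt].
Qed.

Lemma hull_center G p : subgroup G -> (exists2 f, G f & f p <> p) -> hull G p p.
Proof.
move=> sG [f Gf fp].
have f'p : val (f p) < val p -> val p < val ((f^-1)%g p).
  by rewrite -(PLo_lt f^-1%g) PLoKV.
have f''p : val p < val (f p) -> val ((f^-1)%g p) < val p.
  by rewrite -(PLo_lt f^-1%g) PLoKV.
have Gf' : G f^-1%g by exact: subgroupV.
have [pf|pf|/val_inj] := ltgtP (val (f p)) (val p); last by [].
  by split; [exists f|exists f^-1%g => //; exact: f'p].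
by split; [exists f^-1%g => //; exact: f''p|exists f].
Qed.

Lemma hull_push G p x y : subgroup G -> hull G p x -> hull G p y ->
  exists2 g, G g & val y < val (g x).
Proof.
move=> sG [[u Gu ux] _] [_ [v Gv yv]].
exists (v * u^-1)%g; first by apply: subgroupM => //; exact: subgroupV.
apply: lt_trans yv _.
by rewrite -[v p](_ : (v * u^-1)%g (u p) = _) ?PLo_lt// PLoM PLoKV.
Qed.

(** The finitely many generators have slope 1 at both ends of the hull, so they are all trivial on
    common neighbourhoods of these ends; [x] and [y] are orbit points there. If the orbit of [p]
    under [gens s] left the box, it would contain a point fixed by [gens s], and [p] would be
    fixed. *)
Lemma compact_support G p (s : seq P) : subgroup G ->
  (forall f, f \in s -> derived G f) -> (exists2 f, gens s f & f p <> p) ->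
  exists x y, [/\ hull G p x, hull G p y, hull (gens s) p `<=` box x y,
    box x y `<=` hull G p &
    forall g z, gens s g -> hull G p z -> ~ box x y z -> g z = z].
Proof.
move=> sG sd mv.
have sGG : gens s `<=` G.
  by apply: generated_sub => // f /sd; exact: derived_sub.
have mvG : exists2 f, G f & f p <> p by case: mv => f /sGG; exists f.
have onend b : exists2 x, hull G p x & exists e, [/\ 
    0 < gap b e x, (forall z, hull G p z -> 0 < gap b e z) &
    forall g z, gens s g -> 0 < gap b e z <= gap b e x -> g z = z].
  have [e [Ge Gp Gd]] := orbit_end b sG mvG.
  have ne : approached b e.
    by move=> d /Gd[g Gg gd]; exists (g p); rewrite Gp.
  have [phi [phiP phiM]] := germ_hom sG Ge ne.
  have [|d d0 dP] := @germ_common b e s phi.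
    by move=> u /sd /(derived_sub sG); exact: phiP.
  have [g Gg gd] := Gd _ d0.
  exists (g p); first by apply: hull_preserves => //; exact: hull_center.
  exists e; split; first exact: Gp.
    move=> z [[u Gu uz] [v Gv zv]]; have := Gp _ Gu; have := Gp _ Gv.
    by rewrite /gap; case: (b); rewrite ?expr0 ?expr1 ?mul1r ?mulN1r; lra.
  move=> h z sh /andP[z0 zg].
  suff : gens s `<=` [set f | f z = z] by exact.
  apply: generated_sub.
    apply/subgroupP; split=> // [f f' fz f'z|f fz].
      by rewrite /= f'z.
    by change ((f^-1)%g z = z); rewrite -{1}(fz : f z = z) PLoKV.
  move=> f /= fs; apply: (@gap_inj b e).
  rewrite dP//; last by rewrite ltW//= (le_trans zg)// ltW.
  by rewrite (hom_derived sG phiM (sd _ fs)) expR0 mul1r.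
have [x Ox [e [xe Oe ex]]] := onend true.
have [y Oy [e' [ye' Oe' e'y]]] := onend false.
have triv g z : gens s g -> hull G p z -> ~ box x y z -> g z = z.
  move=> sg Oz /negP; rewrite negb_and -!ltNge => /orP[zx|yz].
    by apply: ex => //; rewrite Oe//= /gap expr1 !mulN1r; lra.
  by apply: e'y => //; rewrite Oe'//= /gap expr0 !mul1r; lra.
exists x, y; split => //.
  move=> z [[u su uz] [v sv zv]]; apply: contrapT => nz.
  have Hp : hull G p p by exact: hull_center.
  have fixp w : gens s w -> ~ box x y (w p) -> False.
    move=> sw nw; case: mv => f sf; apply.
    have gw g : gens s g -> g (w p) = w p.
      by move=> sg; apply: triv => //; apply: hull_preserves => //; exact: sGG.
    have sw' := subgroupV (generated_subgroup _) sw.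
    have pE : w p = p by rewrite -[RHS](PLoKV w) gw.
    by rewrite -{1}pE gw.
  move/negP: nz; rewrite negb_and -!ltNge => /orP[zx|yz].
    by apply: (fixp u) => // /andP[]; lra.
  by apply: (fixp v) => // /andP[]; lra.
move=> z /andP[xz zy]; case: Ox Oy => -[u Gu ux] _ [_ [v Gv yv]].
by split; [exists u|exists v] => //;
  [exact: lt_le_trans xz|exact: le_lt_trans yv].
Qed.

Lemma box_displaced h x y : val y < val (h x) ->
  forall m z, box x y z -> ~ box x y ((h ^+ m.+1)%g z).
Proof.
move=> yhx m z /[dup] zxy /andP[xz zy] /andP[_].
apply/negP; rewrite -ltNge.
have xy : val x <= val y by exact: le_trans zy.
elim: m => [|m IH].
  by rewrite expg1; apply: lt_le_trans yhx _; rewrite PLo_le.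
rewrite expgS PLoM; apply: lt_le_trans yhx _; rewrite PLo_le.
exact: le_trans (ltW IH).
Qed.

Lemma tower_extend n G p (s : seq P) : subgroup G ->
  (forall f, f \in s -> derived G f) -> (exists2 f, gens s f & f p <> p) ->
  tower n (gens s) (hull (gens s) p) -> tower n.+1 G (hull G p).
Proof.
move=> sG sd mv tw.
have sGG : gens s `<=` G.
  by apply: generated_sub => // f /sd; exact: derived_sub.
have [x [y [Ox Oy sxy xyO triv]]] := compact_support sG sd mv.
have [h Gh yhx] := hull_push sG Ox Oy.
split => //.
- by exists x.
- by move=> g; exact: hull_preserves.
exists (gens s), (hull (gens s) p), (box x y), h; split => //.
by split => //; exact: box_displaced.
Qed.

(** The induction builds a tower inside [derived G] and puts one storey on top of it: finitely many
    elements of [G] suffice to have the generators found so far in their derived subgroup. *)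
Lemma tower_of_derived n G p (f : P) : subgroup G ->
  iter n (@derived P) G f -> f p <> p ->
  exists s : seq P, [/\ forall g, g \in s -> G g,
    exists2 g, gens s g & g p <> p & tower n (gens s) (hull (gens s) p)].
Proof.
elim: n G => [|n IH] G sG fG fp.
  exists [:: f]; split; first by move=> g; rewrite inE => /eqP->.
    by exists f => //; apply: sub_generated; rewrite /= inE.
  have sf := @generated_subgroup P [set` [:: f]].
  split => //; last by move=> g; exact: hull_preserves.
  exists p; apply: hull_center => //.
  by exists f => //; apply: sub_generated; rewrite /= inE.
rewrite iterSr in fG.
have [s [sG' mv tw]] := IH _ (@generated_subgroup _ _) fG fp.
have [r rG rs] := derived_finitary sG'.
exists r; split => //.
  case: mv => g sg gp; exists g => //; move: g sg {gp}.
  apply: generated_sub; first exact: generated_subgroup.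
  by move=> g /= /rs; apply: derived_sub; exact: generated_subgroup.
exact: (tower_extend (@generated_subgroup _ _) rs mv tw).
Qed.

End Germs.

(** * Generating sets without short relations *)

Section Scattered.
Variables (R : realType) (T : groupType) (G : set T) (phi : T -> R).
Hypotheses (sG : subgroup G)
  (phiM : forall f g, G f -> G g -> phi (f * g)%g = phi f + phi g).
Implicit Types (X : seq T) (w : seq (T * bool)).

Lemma word_eval_subgroup w : (forall l, l \in w -> G l.1) -> G (word_eval w).
Proof.
move=> wG; apply: subgroup_prod => // l /wG Gl; case: ifP => // _.
exact: subgroupV.
Qed.

Lemma hom_word_eval w : (forall l, l \in w -> G l.1) ->
  phi (word_eval w) = \sum_(l <- w) (-1) ^+ l.2 * phi l.1.
Proof.
have hom1 := hom1 sG phiM; have homV := homV sG phiM.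
elim: w => [|l w IH] wG; first by rewrite /word_eval !big_nil hom1.
have wG' k : k \in w -> G k.1 by move=> kw; apply: wG; rewrite inE kw orbT.
have Gl : G l.1 by apply: wG; rewrite mem_head.
rewrite big_cons -IH// /word_eval big_cons phiM.
- by case: (l.2); rewrite ?homV ?expr0 ?expr1 ?mul1r ?mulN1r.
- by case: (l.2) => //; exact: subgroupV.
- exact: word_eval_subgroup wG'.
Qed.

Definition scattered (D : nat) (C : R) X := forall w, (size w <= D)%N ->
  (forall l, l \in w -> l.1 \in X) ->
  phi (word_eval w) = 0 \/ C < `|phi (word_eval w)|.

(** If the exponent sum of [f] in the word is 0, deleting [f] does not change [phi]. Otherwise its
    contribution is at least [phi f] in absolute value, and the other letters cannot bring it below
    [C]. *)
Lemma scattered_cons D C M X f : (forall x, x \in X -> G x) -> G f ->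
  0 <= M -> (forall x, x \in X -> `|phi x| <= M) -> C + M *+ D < `|phi f| ->
  scattered D C X -> scattered D C (f :: X).
Proof.
move=> XG Gf M0 XM fM sX w wD wX.
have wG l : l \in w -> G l.1.
  by move=> /wX; rewrite inE => /predU1P[->|/XG].
pose w' := [seq l <- w | l.1 != f].
have w'X l : l \in w' -> l.1 \in X.
  by rewrite mem_filter => /andP[lf /wX]; rewrite inE (negbTE lf).
have w'D : (size w' <= D)%N.
  by rewrite (leq_trans _ wD)// size_filter count_size.
have [a aE] : exists a : int,
    \sum_(l <- w | l.1 == f) (-1) ^+ l.2 * phi l.1 = a%:~R * phi f.
  exists (\sum_(l <- w | l.1 == f) (-1) ^+ l.2).
  rewrite rmorph_sum /= mulr_suml; apply: eq_bigr => l /eqP ->.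
  by rewrite rmorph_sign.
have w'E : \sum_(l <- w | l.1 != f) (-1) ^+ l.2 * phi l.1 = phi (word_eval w').
  by rewrite hom_word_eval ?big_filter// => l /w'X/XG.
rewrite hom_word_eval// (bigID (fun l => l.1 == f)) /= aE w'E.
have [->|a0] := eqVneq a 0; first by rewrite mul0r add0r; exact: sX.
right.
have w'M : `|phi (word_eval w')| <= M *+ D.
  rewrite hom_word_eval; last by move=> l /w'X/XG.
  apply: le_trans (ler_norm_sum _ _ _) _.
  apply: (@le_trans _ _ (\sum_(l <- w') M)).
    rewrite big_seq [leRHS]big_seq; apply: ler_sum => l lw'.
    rewrite normrM normrX normrN1 expr1n mul1r.
    exact/XM/w'X.
  by rewrite big_const_seq count_predT iter_addr_0 ler_wpMn2l.
have : `|phi f| <= `|a%:~R * phi f|.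
  rewrite normrM ler_peMl// -intr_norm -[1]/(1%:~R) ler_int.
  by rewrite -gtz0_ge1 normr_gt0.
have := lerB_normD (a%:~R * phi f) (phi (word_eval w')).
lra.
Qed.

(** Each new generator is multiplied by a power of one element [h'], itself a power of [h], large
    enough for [scattered_cons]. As [h'] stays in [X], the original generator can be recovered. *)
Lemma scattered_generators h D (C : R) (s : seq T) : G h -> phi h != 0 ->
  0 <= C -> (forall x, x \in s -> G x) ->
  exists X : seq T, [/\ forall x, x \in X -> G x,
    forall x, x \in X -> phi x != 0,
    scattered D C X & forall x, x \in s -> gens X x].
Proof.
move=> Gh h0 C0.
have hom1 := hom1 sG phiM; have homX := homX sG phiM.
have big_shift (a b M : R) : b != 0 -> exists n : nat, M < `|a + b *+ n|.
  move=> b0; exists (Num.bound ((`|M| + `|a|) / `|b|)).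
  set k := Num.bound _.
  have : (`|M| + `|a|) / `|b| < k%:R.
    by apply: archi_boundP; rewrite divr_ge0// addr_ge0.
  rewrite ltr_pdivrMr ?normr_gt0// => kM.
  have := lerB_normD (b *+ k) a.
  rewrite normrMn [_ + a]addrC -[`|b| *+ k]mulr_natl.
  have := ler_norm M; lra.
move=> sG'; suff [X [h' [XG X0 sX h'X Xs]]] : exists X h',
    [/\ forall x, x \in X -> G x, forall x, x \in X -> phi x != 0,
      scattered D C X, h' \in X & forall x, x \in s -> gens X x].
  by exists X.
have pos_neq0 (x : T) : C < `|phi x| -> phi x != 0.
  by move=> Cx; rewrite -normr_gt0; exact: le_lt_trans Cx.
elim: s sG' => [_|f s IH sG'].
  have [n nC] := big_shift 0 (phi h) C h0; rewrite add0r -homX// in nC.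
  have Gn : G (h ^+ n)%g by exact: subgroupX.
  exists [:: (h ^+ n)%g], (h ^+ n)%g; split => //.
  - by move=> x; rewrite inE => /eqP->.
  - by move=> x; rewrite inE => /eqP->; exact: pos_neq0.
  - apply: (@scattered_cons _ _ 0) => //; first by rewrite mul0rn addr0.
    move=> [|l w] _ w0; last by have := w0 l (mem_head _ _).
    by left; rewrite /word_eval big_nil hom1.
  - by rewrite mem_head.
have [|X [h' [XG X0 sX h'X Xs]]] := IH.
  by move=> x xs; apply: sG'; rewrite inE xs orbT.
have Gf : G f by apply: sG'; rewrite mem_head.
pose M := \sum_(x <- X) `|phi x|.
have M0 : 0 <= M by exact: sumr_ge0.
have XM x : x \in X -> `|phi x| <= M.
  move=> xX; rewrite /M (perm_big _ (perm_to_rem xX)) big_cons/= lerDl.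
  exact: sumr_ge0.
have [n nC] := big_shift (phi f) (phi h') (C + M *+ D) (X0 _ h'X).
have Gh' := XG _ h'X.
rewrite -homX// -phiM// in nC; last exact: subgroupX.
have Gx : G (f * h' ^+ n)%g by apply: subgroupM => //; exact: subgroupX.
exists ((f * h' ^+ n)%g :: X), h'; split.
- by move=> x; rewrite inE => /predU1P[->|/XG].
- move=> x; rewrite inE => /predU1P[->|/X0//]; apply: pos_neq0.
  by apply: le_lt_trans nC; rewrite lerDl mulrn_wge0.
- exact: (scattered_cons XG Gx M0 XM nC sX).
- by rewrite inE h'X orbT.
have sgen := @generated_subgroup T [set` (f * h' ^+ n)%g :: X].
move=> x; rewrite inE => /predU1P[->|xs].
  rewrite -[X in gens _ X](mulgK (h' ^+ n)%g); apply: (subgroupM sgen).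
    by apply: sub_generated; rewrite /= mem_head.
  apply: (subgroupV sgen); apply: (subgroupX _ sgen).
  by apply: sub_generated; rewrite /= inE h'X orbT.
apply: (generatedS _ (Xs _ xs)) => y /= yX.
by rewrite inE yX orbT.
Qed.

End Scattered.

Local Ltac lia_sign := rewrite ?expr0 ?expr1 ?mul1r ?mulN1r; lia.

(** * Words in the twisted generators *)

Section NormalForm.
Variables (R : realType) (n : nat) (x : nat -> PLo R).
Local Notation P := (PLo R).
Implicit Types (w : seq (option nat * bool)) (t : P).

(* These exponents differ from each other and from 0 by more than [n], so that
   runs of at most [n] letters [t^(+-1)] cannot cancel them. *)
Definition twist (i : nat) : nat := (n.+1 * i.+1)%N.

Definition twisted t (o : option nat) : P :=
  if o is Some i then (t ^+ twist i * x i * t ^+ twist i)%g else t.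

(* The pair (m, s) stands for [t^m] followed by the steps [s], in which every
   mover is followed by a power of [t]. *)
Fixpoint normal_form w : int * seq (P + unit * int) :=
  match w with
  | [::] => (0, [::])
  | (None, b) :: w => ((-1) ^+ b + (normal_form w).1, (normal_form w).2)
  | (Some i, b) :: w => ((-1) ^+ b * (twist i)%:Z,
      [:: inl (if b then (x i)^-1%g else x i),
          inr (tt, (-1) ^+ b * (twist i)%:Z + (normal_form w).1)
        & (normal_form w).2])
  end.

Definition normal_steps w : seq (P + unit * int) :=
  inr (tt, (normal_form w).1) :: (normal_form w).2.

Lemma normal_steps_eval t w : steps_eval (fun=> t) (normal_steps w) =
  word_eval [seq (twisted t l.1, l.2) | l <- w].
Proof.
elim: w => [| [ o b] w IH].
  by rewrite /word_eval /steps_eval !big_cons !big_nil mulg1.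
rewrite map_cons [RHS]/word_eval big_cons -/(word_eval _) -IH.
rewrite /steps_eval /normal_steps !big_cons /= ?mulgA.
case: o => [i|] /=; rewrite ?big_cons /=.
  rewrite !mulgA zpowD !mulgA; congr (_ * _ * _)%g; case: b.
    by rewrite expr1 mulN1r zpowNn !invgM !mulgA.
  by rewrite expr0 mul1r zpow_nat.
by rewrite zpowD; case: b; rewrite ?expr1 ?expr0 ?zpowN zpow1.
Qed.

Definition noncancelling w :=
  sorted (fun l l' => ~~ ((l.1 == l'.1) && (l.2 != l'.2))) w.

Lemma twist_gap i j : (i < j)%N -> (twist i + n.+1 <= twist j)%N.
Proof. by move=> ij; rewrite /twist -mulnSr leq_pmul2l. Qed.

Lemma twist_gt i : (n < twist i)%N.
Proof. by rewrite /twist mulnS leq_addr. Qed.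

(* [k] is the length of the run of letters [t^(+-1)] at the head of [w] and [c]
   the contribution of the first other letter. *)
Lemma normal_form_neq0 w : noncancelling w -> (size w <= n)%N ->
  all (fun c => if c is inr l then l.2 != 0 else true) (normal_form w).2 /\
  exists (b : bool) (k : nat) (c : int),
  [/\ (normal_form w).1 = (-1) ^+ b * k%:Z + c, (k <= size w)%N,
    (0 < k)%N -> ohead w = Some (None, b) &
    (c = 0 /\ (k = 0%N -> w = [::])) \/
    exists (i : nat) (b' : bool), c = (-1) ^+ b' * (twist i)%:Z /\
      (k = 0%N -> ohead w = Some (Some i, b'))].
Proof.
elim: w => [| [ o b] w IH] /=.
  by split => //; exists false, 0%N, 0; split => //; left.
move=> bw sw.
have [nz [b' [k [c [mE kw hd cE]]]]] := IH (path_sorted bw) (ltnW sw).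
have hd_ok l : ohead w = Some l -> ~~ ((o == l.1) && (b != l.2)).
  by case: w bw {IH sw nz mE kw hd cE} => //= l' w /andP[ll' _] [<-].
case: o bw hd_ok => [i|] bw hd_ok /=; last first.
  split => //; exists b, k.+1, c; split => //.
    rewrite mE addrA; congr (_ + _); case: k hd {kw mE cE} => [|k] hd.
      by rewrite mulr0 addr0 mulr1.
    by have := hd_ok _ (hd isT) => /=; rewrite negbK => /eqP ->; lia.
  case: cE => [[c0 _]|[i [b'' [cE _]]]]; first by left.
  by right; exists i, b''.
split; last first.
  by exists b, 0%N, ((-1) ^+ b * (twist i)%:Z); split => //;
    [rewrite mulr0 add0r|right; exists i, b].
rewrite nz andbT mE.
have kn : (k < n)%N by exact: leq_ltn_trans kw _.
have ti := twist_gt i.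
case: cE => [[-> _]|[j [b'' [-> k0]]]].
  by rewrite addr0; apply/eqP; case: (b); case: (b'); lia_sign.
have tj := twist_gt j.
have [ij|ji|ij] := ltngtP i j.
- have tw := twist_gap ij.
  by apply/eqP; case: (b); case: (b'); case: (b''); lia_sign.
- have tw := twist_gap ji.
  by apply/eqP; case: (b); case: (b'); case: (b''); lia_sign.
(* For equal indices and no [t] in between, the two signs agree as the word does not cancel, and the
   twists add up. For a nonempty run, opposite signs leave the run, and equal signs outweigh it. *)
rewrite -ij in k0 tj *; case: k k0 {mE kw hd} kn => [|k] k0 kn.
  have := hd_ok _ (k0 erefl); rewrite /= eqxx /= negbK => /eqP <-.
  by apply/eqP; case: (b); case: (b'); lia_sign.
by apply/eqP; case: (b); case: (b'); case: (b''); lia_sign.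
Qed.

Lemma normal_steps_neq0 w : noncancelling w -> (size w <= n)%N -> w <> [::] ->
  all (fun c => if c is inr l then l.2 != 0 else true) (normal_steps w).
Proof.
move=> nw sw w0; have [nz [b [k [c [mE kw _ cE]]]]] := normal_form_neq0 nw sw.
rewrite /= nz andbT mE; have {}kw := leq_trans kw sw.
case: cE => [[-> k0]|[i [b' [-> _]]]].
  case: k k0 {mE kw} => [/(_ erefl)//|k _].
  by apply/eqP; case: (b); lia_sign.
by have tw := twist_gt i; apply/eqP; case: (b); case: (b'); lia_sign.
Qed.

(** Each place is the product of the movers in a suffix of [w], that is, of the letters other than
    [t]. Two places thus differ by at most twice the length of [w]. *)
Lemma normal_steps_words w u :
  u \in displacement (normal_steps w) :: visited (normal_steps w) ->
  exists v : seq (P * bool), [/\ (size v <= size w)%N,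
    forall l, l \in v -> exists2 i, l.1 = x i & (Some i, l.2) \in w &
    u = word_eval v].
Proof.
rewrite /normal_steps /= displacement_inr inE orb_idl; last first.
  by move=> /eqP ->; rewrite mem_head.
elim: w u => [| [ o b] w IH] u.
  rewrite /= inE => /eqP ->; exists [::]; split => //.
  by rewrite /word_eval /displacement !big_nil.
have tl v : [/\ (size v <= size w)%N,
    forall l, l \in v -> exists2 i, l.1 = x i & (Some i, l.2) \in w &
    u = word_eval v] ->
    exists v : seq (P * bool), [/\ (size v <= (size w).+1)%N,
    forall l, l \in v -> exists2 i, l.1 = x i & (Some i, l.2) \in (o, b) :: w &
    u = word_eval v].
  move=> [sv vw ->]; exists v; split => //; first exact: leqW.
  by move=> l /vw[i li iw]; exists i => //; rewrite inE iw orbT.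
case: o tl => [i|] tl; last by move=> /= /IH[v]; exact: tl.
rewrite /= displacement_inl displacement_inr inE.
move=> /predU1P[->|/IH[v]]; last exact: tl.
have [v [sv vw vE]] := IH _ (mem_head _ _).
exists ((x i, b) :: v); split => //.
  move=> l; rewrite inE => /predU1P[->|/vw[k lk kw]].
    by exists i => //; rewrite mem_head.
  by exists k => //; rewrite inE kw orbT.
by rewrite /word_eval big_cons vE; case: (b).
Qed.

Lemma size_emission_normal_steps (V : Type) (p : P -> V) w :
  (size (emission p (normal_steps w)) <= (size w).+1)%N.
Proof.
rewrite /normal_steps /= ltnS.
by elim: w => [//| [[i|] b] w IH] //=; exact: leqW.
Qed.

Lemma emission_neq0 (V : Type) (p : P -> V) (s : seq (P + unit * int)) :
  all (fun c => if c is inr l then l.2 != 0 else true) s ->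
  all (fun l => l.2 != 0) (emission p s).
Proof. by elim: s => [//|[u|l] s IH] //= /andP[-> /IH]. Qed.

(** Consecutive powers of [t] are separated by exactly one mover, and this mover changes the value
    of [phi]. *)
Lemma normal_steps_sorted (phi : P -> R) (G : set P) w : subgroup G ->
  (forall f g, G f -> G g -> phi (f * g)%g = phi f + phi g) ->
  (forall i b, (Some i, b) \in w -> G (x i) /\ phi (x i) != 0) ->
  sorted (fun l l' => l.1 != l'.1) (emission phi (normal_steps w)).
Proof.
move=> sG phiM; rewrite /normal_steps; move: (normal_form w).1 => m.
elim: w m => [//| [[i|] b] w IH] m wG /=; last first.
  by apply: IH => i b' iw; apply: (wG i b'); rewrite inE iw orbT.
have Gw j b' : (Some j, b') \in w -> G (x j) /\ phi (x j) != 0.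
  by move=> jw; apply: (wG j b'); rewrite inE jw orbT.
apply/andP; split; last exact: IH.
rewrite displacement_inl displacement_inr.
set D := displacement _.
have GD : G D.
  have [v [_ vw ->]] : exists v : seq (P * bool), [/\ (size v <= size w)%N,
      forall l, l \in v -> exists2 i, l.1 = x i & (Some i, l.2) \in w &
      D = word_eval v].
    apply: normal_steps_words.
    by rewrite /normal_steps displacement_inr mem_head.
  apply: word_eval_subgroup => // l /vw[j -> jw]; exact: (Gw j l.2 jw).1.
have [Gi i0] := wG i b (mem_head _ _).
have GV : G (x i)^-1%g by exact: subgroupV.
apply/eqP => -[]; case: (b); rewrite phiM//.
  rewrite (homV sG phiM)// => /eqP.
  by rewrite -subr_eq0 addrK oppr_eq0 (negbTE i0).
by move=> /eqP; rewrite -subr_eq0 addrK (negbTE i0).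
Qed.

End NormalForm.

(** Any choice of labels works even if [el] is not injective: neighbours with equal labels are equal
    elements, so cancelling labels would come from cancelling letters. *)
Lemma word_eval_lift (R : realType) (A : eqType) (el : A -> PLo R) (B : seq A)
  (w : seq (PLo R * bool)) : (forall l, l \in w -> l.1 \in map el B) ->
  reduced w ->
  exists w' : seq (A * bool), [/\ [seq (el l.1, l.2) | l <- w'] = w,
    forall l, l \in w' -> l.1 \in B &
    sorted (fun l l' => ~~ ((l.1 == l'.1) && (l.2 != l'.2))) w'].
Proof.
elim: w => [|[f b] w IH] wB rw; first by exists [::].
have [|w' [wE w'B sw']] := IH _ (path_sorted rw).
  by move=> l lw; apply: wB; rewrite inE lw orbT.
have /mapP[a aB fa] : f \in map el B by exact: (wB (f, b) (mem_head _ _)).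
exists ((a, b) :: w'); split.
- by rewrite /= wE fa.
- by move=> l; rewrite inE => /predU1P[->|/w'B].
case: w' wE sw' {w'B} => //= l w' wE ->; rewrite andbT.
move: rw; rewrite /reduced -wE /= => /andP[+ _].
by apply: contra => /andP[/eqP <- ->]; rewrite fa eqxx.
Qed.

(** * Copies of the support near the right end, and the generating set *)

Section Main.
Variable R : realType.
Local Notation P := (PLo R).
Local Notation X := (unit_itv R).
Implicit Types (f g h u : P) (x y z e p : X) (G H : set P) (O K : set X).

Lemma ln_ratio_bound (r1 r2 a b s s' c : R) :
  0 < r1 -> r1 <= a <= r2 -> r1 <= b <= r2 ->
  expR s * (expR c * a) = expR s' * (expR c * b) ->
  `|s - s'| <= `|ln (r2 / r1)|.
Proof.
move=> r10 /andP[r1a ar2] /andP[r1b br2].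
have a0 := lt_le_trans r10 r1a; have b0 := lt_le_trans r10 r1b.
have r20 := lt_le_trans a0 ar2.
rewrite !(mulrCA _ (expR c)) => /(mulfI (lt0r_neq0 (expR_gt0 _))).
move=> /(congr1 (@ln R)); rewrite !lnM ?posrE ?expR_gt0 ?invr_gt0// !expRK.
rewrite lnV ?posrE// => E.
rewrite -ler_ln ?posrE// in r1a; rewrite -ler_ln ?posrE// in ar2.
rewrite -ler_ln ?posrE// in r1b; rewrite -ler_ln ?posrE// in br2.
have := ler_norm (ln r2 - ln r1) => r21.
by rewrite ler_norml; apply/andP; split; lra.
Qed.

(** First [g0] pushes the box to where [h] is a linear contraction, then a power of [h] brings it to
    where all of [us] are linear. Contraction keeps ratios of distances to [e], so [C] depends on
    [g0] only, and [us] may be chosen after it. *)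
Lemma scaled_copies G p e (phi : P -> R) h x y : subgroup G ->
  (forall g, G g -> 0 < gap false e (g p)) ->
  (forall d, 0 < d -> exists2 g, G g & gap false e (g p) < d) ->
  (forall f, G f -> germ false e f (phi f)) ->
  G h -> phi h < 0 -> hull G p p -> hull G p x -> hull G p y ->
  exists2 C : R, 0 <= C & forall us : seq P, (forall u, u \in us -> G u) ->
  exists2 g, G g &
    (forall u u' z z', u \in us -> u' \in us -> box x y z -> box x y z' ->
       u (g z) = u' (g z') -> `|phi u - phi u'| <= C) /\
    (forall u u' z, u \in us -> u' \in us -> box x y z ->
       phi u = phi u' -> u (g z) = u' (g z)).
Proof.
move=> sG Gp Gd phiP Gh h0 Op Ox Oy.
have [d d0 hd] := phiP h Gh.
have [g1 Gg1 g1d] := Gd d d0.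
have [|g0 Gg0 g0x] := hull_push sG Ox (_ : hull G p (g1 p)).
  exact: hull_preserves.
have gap_hull z : hull G p z -> 0 < gap false e z.
  move=> [_ [v Gv zv]]; have := Gp v Gv.
  by rewrite /gap expr0 !mul1r; lra.
set r2 := gap false e (g0 x); set r1 := gap false e (g0 y).
have r10 : 0 < r1 by apply: gap_hull; exact: hull_preserves.
have r20 : 0 < r2 by apply: gap_hull; exact: hull_preserves.
have r2d : r2 <= d.
  by move: g0x g1d; rewrite /r2 /gap expr0 !mul1r; lra.
have boxr z : box x y z -> r1 <= gap false e (g0 z) <= r2.
  move=> /andP[xz zy]; rewrite !gap_le /gap expr0 !mul1r.
  by apply/andP; lra.
exists (`|ln (r2 / r1)|) => // us usG.
have [|d' d'0 usd] := @germ_common _ false e us phi.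
  by move=> u /usG; exact: phiP.
have [Q Qd'] : exists Q : nat, r2 * expR (phi h *+ Q) <= d'.
  have c0 : expR (phi h) < 1 by rewrite -expR0 ltr_expR.
  pose Q := Num.bound (`|ln (d' / r2)| / - phi h); exists Q.
  have : `|ln (d' / r2)| / - phi h < Q%:R.
    by apply: archi_boundP; rewrite divr_ge0// oppr_ge0 ltW.
  rewrite ltr_pdivrMr ?oppr_gt0// => hQ.
  rewrite mulrC -ler_pdivlMr//.
  have dr0 : 0 < d' / r2 by rewrite divr_gt0.
  rewrite -[leRHS]lnK// ler_expR -mulr_natl.
  have := ler_norm (- ln (d' / r2)); rewrite normrN; lra.
have hQ z q : box x y z ->
    gap false e ((h ^+ q)%g (g0 z)) = expR (phi h *+ q) * gap false e (g0 z).
  move=> /boxr/andP[z1 z2]; have z0 := lt_le_trans r10 z1.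
  elim: q => [|q IH]; first by rewrite mulr0n expR0 mul1r.
  rewrite expgS PLoM hd IH; first by rewrite mulrA -expRD -mulrS.
  rewrite mulr_ge0 ?expR_ge0 ?(ltW z0)//=.
  apply: le_trans (le_trans z2 r2d); rewrite ger_pMl//.
  by rewrite -expR0 ler_expR mulrn_wle0// ltW.
have GQ : G (h ^+ Q)%g by exact: subgroupX.
exists (h ^+ Q * g0)%g; first exact: subgroupM.
have uE u z : u \in us -> box x y z -> gap false e (u ((h ^+ Q * g0)%g z)) =
    expR (phi u) * (expR (phi h *+ Q) * gap false e (g0 z)).
  move=> uus zxy; rewrite PLoM usd ?hQ//.
  have /andP[z1 z2] := boxr _ zxy; have z0 := lt_le_trans r10 z1.
  rewrite mulr_ge0 ?expR_ge0 ?(ltW z0)//=; apply: le_trans Qd'.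
  by rewrite mulrC ler_pM2r// expR_gt0.
split=> [u u' z z' uus u'us zxy z'xy|u u' z uus u'us zxy uu']; last first.
  by apply: (@gap_inj _ false e); rewrite !uE// uu'.
move=> /(congr1 (gap false e)); rewrite !uE//.
exact: (ln_ratio_bound r10 (boxr _ zxy) (boxr _ z'xy)).
Qed.

(** If [phi] vanished on [G], the finitely many generators would fix a neighbourhood of [e]. It
    contains an orbit point, so [p] would be fixed as well. *)
Lemma contraction_exists G (s0 : seq P) p e (phi : P -> R) :
  subgroup G -> gens s0 = G -> (forall g, G g -> 0 < gap false e (g p)) ->
  (forall d, 0 < d -> exists2 g, G g & gap false e (g p) < d) ->
  (forall f, G f -> germ false e f (phi f)) ->
  (forall f g, G f -> G g -> phi (f * g)%g = phi f + phi g) ->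
  (exists2 f, G f & f p <> p) -> exists2 h, G h & phi h < 0.
Proof.
move=> sG s0G Gp Gd phiP phiM [f Gf fp]; apply: contrapT => nh.
have phi0 h : G h -> phi h = 0.
  move=> Gh; have [h0|h0|//] := ltgtP (phi h) 0; first by case: nh; exists h.
  case: nh; exists h^-1%g; first exact: subgroupV.
  by rewrite (homV sG phiM)// oppr_lt0.
have s0G' u : u \in s0 -> G u by move=> us; rewrite -s0G; exact: sub_generated.
have [|d d0 dP] := @germ_common _ false e s0 phi.
  by move=> u /s0G'; exact: phiP.
have [g Gg gd] := Gd d d0; apply: fp.
have fixg : G `<=` [set u | u (g p) = g p].
  rewrite -{1}s0G; apply: generated_sub.
    apply/subgroupP; split=> // [u v ug vg|u ug].
      by rewrite /= vg.
    by change ((u^-1)%g (g p) = g p); rewrite -{1}(ug : u (g p) = g p) PLoKV.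
  move=> u /= us; apply: (@gap_inj _ false e).
  rewrite dP//; first by rewrite phi0 ?expR0 ?mul1r//; exact: s0G'.
  by rewrite !ltW//; exact: Gp.
have pg : p = g p.
  by rewrite -{1}(PLoKV g p); apply: fixg; exact: subgroupV.
rewrite pg; exact: fixg.
Qed.

Fixpoint words_upto (A : eqType) (B : seq A) n : seq (seq A) :=
  if n is n'.+1 then [::] :: [seq a :: w | a <- B, w <- words_upto B n']
  else [:: [::]].

Lemma words_uptoP (A : eqType) (B : seq A) n w :
  reflect ((size w <= n)%N /\ {subset w <= B}) (w \in words_upto B n).
Proof.
apply: (iffP idP).
  elim: n w => [|n IH] w; first by rewrite /= inE => /eqP ->.
  rewrite /= inE => /predU1P[->//|/allpairsP[[a v] /= [aB /IH[sv vB] ->]]].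
  by split => //= b; rewrite inE => /predU1P[->//|/vB].
elim: n w => [|n IH] w [sw wB].
  by move: sw; rewrite leqn0 size_eq0 => /eqP ->; rewrite mem_head.
case: w sw wB => [|a w] sw wB; first by rewrite mem_head.
rewrite /= inE; apply/orP; right; apply/allpairsP.
exists (a, w) => /=; split => //.
  by apply: wB; rewrite mem_head.
by apply: IH; split => // b bw; apply: wB; rewrite inE bw orbT.
Qed.

Lemma large_generating_set n G (s0 s : seq P) p : subgroup G -> gens s0 = G ->
  (forall f, f \in s -> derived G f) -> (exists2 f, gens s f & f p <> p) ->
  tower n.+2 (gens s) (hull (gens s) p) ->
  exists2 S : seq P, gens S = G & forall w : seq (P * bool),
    w <> [::] -> (size w <= n)%N -> reduced w ->
    (forall l, l \in w -> l.1 \in S) -> word_eval w <> 1%g.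
Proof.
move=> sG s0G sd mv tw.
have sGG : gens s `<=` G.
  by apply: generated_sub => // f /sd; exact: derived_sub.
have mvG : exists2 f, G f & f p <> p by case: mv => f /sGG; exists f.
have [x [y [Ox Oy sxy xyO triv]]] := compact_support sG sd mv.
have [e [Ge Gp Gd]] := orbit_end false sG mvG.
have ne : approached false e.
  by move=> d /Gd[g Gg gd]; exists (g p); rewrite Gp.
have [phi [phiP phiM]] := germ_hom sG Ge ne.
have [h Gh h0] := contraction_exists sG s0G Gp Gd phiP phiM mvG.
have Op := hull_center sG mvG.
have [C C0 copies] := scaled_copies sG Gp Gd phiP Gh h0 Op Ox Oy.
have s0G' u : u \in s0 -> G u by move=> us; rewrite -s0G; exact: sub_generated.
(* The length [n + n] allows for the quotient of two places, each given by a word of length at most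
   [n]. *)
have [xs [xsG xs0 xsC s0xs]] :=
  scattered_generators sG phiM (n + n)%N Gh (ltr0_neq0 h0) C0 s0G'.
pose xi i := nth 1%g xs i.
have xiG i : G (xi i).
  have [ixs|xsi] := ltnP i (size xs); first by apply: xsG; exact: mem_nth.
  by rewrite /xi nth_default//; exact: subgroup1.
pose B : seq (option nat) := None :: map Some (iota 0 (size xs)).
have BP i : (Some i \in B) = (i < size xs)%N.
  by rewrite inE /= mem_map ?mem_iota// => ? ? [].
pose W := [seq w <- words_upto [seq (o, b) | o <- B, b <- [:: true; false]] n |
  noncancelling w && (w != [::])].
have WP w : w \in W -> [/\ noncancelling w, w <> [::], (size w <= n)%N &
    forall l, l \in w -> l.1 \in B].
  rewrite mem_filter => /andP[/andP[nw /eqP w0] /words_uptoP[sw wB]].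
  by split => // l /wB/allpairsP[ [ o b] /= [oB _ ->]].
have wB_phi w : w \in W -> forall i b, (Some i, b) \in w ->
    G (xi i) /\ phi (xi i) != 0.
  move=> /WP[_ _ _ wB] i b /wB; rewrite BP => ixs.
  by split => //; apply: xs0; exact: mem_nth.
pose T w := normal_steps n xi w.
(* The element 1 stands for the place where every walk starts. *)
pose us := 1%g :: flatten [seq displacement (T w) :: visited (T w) | w <- W].
have us_word u : u \in us -> exists v : seq (P * bool), [/\ (size v <= n)%N,
    forall l, l \in v -> l.1 \in xs & u = word_eval v].
  rewrite inE => /predU1P[->|/flatten_mapP[w wW uw]].
    by exists [::]; split => //; rewrite /word_eval big_nil.
  have [v [sv vw ->]] := normal_steps_words uw; exists v.
  have [_ _ sw wB] := WP w wW.
  split; [exact: leq_trans sw|move=> l /vw[i -> /wB]|by []].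
  by rewrite BP; exact: mem_nth.
have usG u : u \in us -> G u.
  by move=> /us_word[v [_ vxs ->]]; apply: word_eval_subgroup => // l /vxs/xsG.
have us1 : 1%g \in us by rewrite mem_head.
have usW w u : w \in W -> u \in displacement (T w) :: visited (T w) -> u \in us.
  by move=> wW uw; rewrite inE; apply/orP; right; apply/flatten_mapP; exists w.
have [g Gg [sep same]] := copies us usG.
have {sep} sep u u' z z' : u \in us -> u' \in us -> box x y z -> box x y z' ->
    u (g z) = u' (g z') -> phi u = phi u'.
  move=> uus u'us zxy z'xy /(sep _ _ _ _ uus u'us zxy z'xy).
  have [v [sv vxs vE]] := us_word _ uus.
  have [v' [sv' v'xs v'E]] := us_word _ u'us.
  (* The second word is inverted letter by letter without being reversed, which [phi] does not
     see. *)
  have := xsC (v ++ [seq (l.1, ~~ l.2) | l <- v']).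
  have vG (l : P * bool) : l \in v -> G l.1 by move=> /vxs/xsG.
  have v'G (l : P * bool) : l \in v' -> G l.1 by move=> /v'xs/xsG.
  have cat_xs (l : P * bool) :
      l \in v ++ [seq (k.1, ~~ k.2) | k <- v'] -> l.1 \in xs.
    by rewrite mem_cat => /orP[/vxs//|/mapP[k /v'xs ? ->]].
  rewrite (hom_word_eval sG phiM); last by move=> l /cat_xs/xsG.
  rewrite big_cat big_map /= (_ : _ + _ = phi u - phi u'); last first.
    rewrite vE v'E !(hom_word_eval sG phiM)// -sumrN; congr (_ + _).
    by apply: eq_bigr => l _; case: l.2; rewrite ?expr0 ?expr1; ring.
  rewrite size_cat size_map leq_add// => /(_ isT cat_xs) [/eqP|].
    by rewrite subr_eq0 => /eqP.
  by move=> /lt_le_trans/[apply]; rewrite ltxx.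
pose ws := [seq emission phi (T w) | w <- W].
(* A word of length [n] emits up to [n.+1] powers of [t], and treating all words together costs one
   more storey: this is the height [n.+2]. *)
have [|a aG law] := @tower_no_laws R n.+1 (unit * R)%type ws (gens s) _ tw.
  move=> _ /mapP[w wW ->]; have [nw w0 sw wB] := WP w wW; split => //.
  - by apply: emission_neq0; exact: normal_steps_neq0.
  - exact: (normal_steps_sorted n sG phiM (wB_phi w wW)).
  - exact: leq_trans (size_emission_normal_steps n xi phi w) _.
(* By [same], places with equal [phi] act alike on the copy of the box, so [t] needs one
   representative for each value of [phi]. *)
pose vs := undup (map phi us).
pose rep v := nth 1%g us (index v (map phi us)).
have rep_us v : v \in vs -> rep v \in us.
  rewrite mem_undup => vus; apply: mem_nth.
  by rewrite -(size_map phi) index_mem.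
have phi_rep v : v \in vs -> phi (rep v) = v.
  rewrite mem_undup => vus; rewrite /rep -(nth_map _ 0) ?nth_index//.
  by rewrite -(size_map phi) index_mem.
have phi_vs u : u \in us -> phi u \in vs by rewrite mem_undup; exact: map_f.
have repG v : v \in vs -> G (rep v * g)%g.
  by move=> /rep_us/usG Gr; exact: subgroupM.
pose t := (\prod_(v <- vs) (rep v * g * a (tt, v) * (rep v * g)^-1))%g.
have aK i : preserves (box x y) (a i).
  apply: (preserves_support xyO).
    by apply: hull_preserves => //; exact: sGG.
  by move=> z; exact: triv.
have tE u z : u \in us -> box x y z -> t (u (g z)) = u (g (a (tt, phi u) z)).
  move=> uus zxy; have uvs := phi_vs _ uus.
  have e1 z' : box x y z' -> u (g z') = rep (phi u) (g z').
    by move=> z'xy; apply: same => //; [exact: rep_us|rewrite phi_rep].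
  rewrite !e1//; last exact: aK.
  rewrite -!PLoM -[LHS]/(t ((rep (phi u) * g)%g z)).
  apply: (@glue_translates R R vs (fun v => rep v * g)%g (fun v => a (tt, v))
    (hull G p) (box x y)) => //.
  - by move=> v /repG; exact: hull_preserves.
  - by move=> v /repG Gv; apply: hull_preserves => //; exact: subgroupV.
  - by move=> v z' Oz' nz'; apply: triv.
  - exact: undup_uniq.
  - move=> v v' z1 z2 vvs v'vs z1xy z2xy.
    rewrite !PLoM => /(sep _ _ _ _ (rep_us _ vvs) (rep_us _ v'vs) z1xy z2xy).
    by rewrite !phi_rep.
have tG : G t.
  apply: subgroup_prod => // v vvs; have Gv := repG v vvs.
  apply: subgroupM => //; last exact: subgroupV.
  by apply: subgroupM => //; exact: sGG.
pose S := map (twisted n xi t) B.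
exists S.
  have sS := @generated_subgroup P [set` S].
  apply/seteqP; split.
    apply: generated_sub => // _ /mapP[[i|] _ ->] //=.
    by do 2?[apply: subgroupM => //]; exact: subgroupX.
  have St : gens S t by apply: sub_generated; rewrite /= /S map_cons mem_head.
  have Sxs f : f \in xs -> gens S f.
    move=> fxs; have : gens S (twisted n xi t (Some (index f xs))).
      apply: sub_generated; rewrite -[X in [set` X] _]/(map (twisted n xi t) B).
      by apply: map_f; rewrite BP index_mem.
    rewrite /= /xi nth_index//.
    set tw' := (t ^+ _)%g => Sf.
    have St' : gens S tw' by exact: (subgroupX _ sS).
    have -> : f = (tw'^-1 * (tw' * f * tw') * tw'^-1)%g.
      by rewrite !mulgA mulVg mul1g mulgK.
    apply: (subgroupM sS); last exact: (subgroupV sS).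
    by apply: (subgroupM sS) => //; exact: (subgroupV sS).
  rewrite -s0G; apply: generated_sub => // f /= /s0xs.
  by apply: generated_sub.
move=> w w0 sw rw wS.
have [w' [w'E w'B nw']] := word_eval_lift wS rw.
have w'W : w' \in W.
  rewrite mem_filter; apply/andP; split.
    apply/andP; split; first exact: nw'.
    by apply/eqP => w'0; apply: w0; rewrite -w'E w'0.
  apply/words_uptoP; split.
    by rewrite -(size_map (fun l => (twisted n xi t l.1, l.2))) w'E.
  move=> [ o b] /w'B oB; apply/allpairsP; exists (o, b); split => //.
  by case: (b).
rewrite -w'E -normal_steps_eval -/(T w') => one.
have [z sz] : exists2 z, hull (gens s) p z &
    syllables_eval a (emission phi (T w')) z <> z.
  by apply: law; exact: map_f.
have sgs := @generated_subgroup P [set` s].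
have aO i : preserves (hull (gens s) p) (a i) by exact: hull_preserves.
have a'O i : preserves (hull (gens s) p) (a i)^-1%g.
  exact: hull_preserves sgs (subgroupV sgs (aG i)).
have := @walk R unit R phi (fun=> t) a g (hull (gens s) p) (T w') aO a'O.
have DT : displacement (T w') \in us by apply: (usW _ _ w'W); rewrite mem_head.
move=> /(_ _)/wrap[].
  move=> [] u uT z' sz'; apply: tE; last exact: sxy.
  by apply: (usW _ _ w'W); rewrite inE uT orbT.
move=> /(_ z sz); rewrite one; set z' := syllables_eval _ _ _ => gz.
have sz' : hull (gens s) p z'.
  exact: (preserves_syllables (emission phi (T w')) aO a'O).
(* The walk ends in the copy where it started, so its displacement has the same [phi] as 1 and acts
   there as the identity. Cancelling [g] makes [z] a fixed point of the emitted word, against the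
   choice of [z]. *)
have D0 : phi 1%g = phi (displacement (T w')).
  by apply: sep gz => //; exact: sxy.
rewrite -(same _ _ z' us1 DT) // in gz; last exact: sxy.
by move: gz => /(can_inj (PLoKV g)) /esym.
Qed.

End Main.

Theorem theorem1p2 (R : realType) (Gamma : set (PLo R)) :
  subgroup Gamma -> finitely_generated Gamma ->
  solvable_group Gamma \/ girth R Gamma = (+oo)%E.
Proof.
move=> sG [S0 [/finite_seqP[s0 ->] s0G]].
have [|nsol] := pselect (solvable_group Gamma); [by left|right].
apply/eqyP => A A0; have := archi_boundP (ltW A0).
set n := Num.bound A => An.
have [f fG [p fp]] : exists2 f, iter n.+3 (@derived (PLo R)) Gamma f &
    exists p, f p <> p.
  apply: contrapT => nf; apply: nsol; exists n.+3; apply/seteqP; split.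
    move=> f fG; apply: PLo_inj; apply/funext => p; apply: contrapT => fp.
    by apply: nf; exists f => //; exists p.
  by move=> _ ->; apply: subgroup1; exact: iter_derived_subgroup.
(* One derivation places the generators [s] in [derived Gamma]; the other [n.+2] give the height of
   the tower. *)
rewrite iterSr in fG.
have [s [sd mv tw]] := tower_of_derived (@generated_subgroup _ _) fG fp.
have [S SG Srel] := large_generating_set sG s0G sd mv tw.
apply: (@le_trans _ _ (girth_wrt R [set` S])); last first.
  apply: ereal_sup_ubound; exists [set` S] => //.
  by split; [exact: finite_seq|exact: SG].
apply: le_ereal_inf_tmp => _ [w [w0 rw wS w1] <-].
rewrite lee_fin (le_trans (ltW An))// ler_nat leqNgt; apply/negP => /ltnW sw.
exact: Srel w0 sw rw wS w1.
Qed.
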